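(* Let $p\ge 1$ and $0<j<2+1/p$. Then for every closed unit-speed curve $c$ of length $2\pi$ in $\mathbf{R}^n$ ($n\ge2$), $$\iint \left(\frac{1}{|c(s)-c(t)|^j}-\frac{1}{d(s,t)^j}\right)^p\,ds\,dt \;\ge\; 2^{3-jp}\,\pi\int_0^{\pi/2}\left(\left(\frac{1}{\sin s}\right)^j-\left(\frac1s\right)^j\right)^p\,ds,$$ with equality if and only if $c$ is the round circle (of radius $1$).
   Context: A closed unit-speed curve of length $2\pi$ in $\mathbf{R}^n$ is an absolutely continuous map $c\colon S^1=\mathbf{R}/2\pi\mathbf{Z}\to\mathbf{R}^n$ with $|c'(t)|=1$ for almost every $t$. Here $|c(s)-c(t)|$ is the distance in $\mathbf{R}^n$, and $d(s,t)=\min_{k\in\mathbf{Z}}|s-t+2\pi k|$ is the shortest distance between $c(s)$ and $c(t)$ along the curve. The double integral on the left (denoted $E_j^p[c]$, O'Hara's energy) is over $S^1\times S^1$; its integrand is nonnegative and the integral may be $+\infty$. *)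

(* Defs.v *)
From mathcomp Require Export all_boot all_order all_algebra.
From mathcomp Require Export all_classical all_reals all_analysis.
Export Order.TTheory GRing.Theory Num.Theory.
Export numFieldNormedType.Exports.

Set Implicit Arguments.
Unset Strict Implicit.
Unset Printing Implicit Defensive.

Local Open Scope classical_set_scope.
Local Open Scope ring_scope.

(* The library's norm on ['rV[R]_n] is the sup norm, so the Euclidean one is
   defined here.  Both induce the same topology, hence the same derivatives. *)
Definition dotv (R : realType) (n : nat) (x y : 'rV[R]_n) : R :=
  \sum_(i < n) x 0 i * y 0 i.

Definition enorm (R : realType) (n : nat) (x : 'rV[R]_n) : R :=
  Num.sqrt (dotv x x).

Definition abs_continuous (R : realType) (n : nat) (a b : R)
    (f : R -> 'rV[R]_n) : Prop :=
  forall e : R, 0 < e -> exists2 d : R, 0 < d &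
    forall (m : nat) (I : 'I_m -> R * R),
      (forall k, a <= (I k).1 /\ (I k).1 <= (I k).2 /\ (I k).2 <= b) ->
      trivIset setT (fun k => `](I k).1, (I k).2[%classic) ->
      \sum_(k < m) ((I k).2 - (I k).1) < d ->
      \sum_(k < m) enorm (f (I k).2 - f (I k).1) < e.

(* A map on S^1 = R/2piZ is a 2pi-periodic map on R; its absolute continuity
   is tested on one period. *)
Definition closed_unit_speed_curve (R : realType) (n : nat)
    (c : R -> 'rV[R]_n) : Prop :=
  [/\ periodic c (2 * pi),
      abs_continuous 0 (2 * pi) c &
      {ae lebesgue_measure, forall t : R,
        derivable c t 1 /\ enorm ('D_1 c t) = 1}].

(* The infimum over k is attained, so it is the minimum. *)
Definition arcdist (R : realType) (s t : R) : R :=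
  inf (range (fun k : int => `|s - t + 2 * pi * k%:~R|)).

(* The inverses are taken in \bar R, where 0^-1 = +oo: the integrand is +oo
   where c s = c t with s, t distinct mod 2pi.  On the null set
   s = t mod 2pi it is (+oo - +oo) `^ p = (-oo) `^ p = 0. *)
Definition ohara_integrand (R : realType) (n : nat) (j p : R)
    (c : R -> 'rV[R]_n) (s t : R) : \bar R :=
  ((((enorm (c s - c t) `^ j)%R%:E)^-1 - ((arcdist s t `^ j)%R%:E)^-1) `^ p)%E.

(* S^1 x S^1 is represented by the fundamental domain [0, 2pi]^2. *)
Definition ohara_energy (R : realType) (n : nat) (j p : R)
    (c : R -> 'rV[R]_n) : \bar R :=
  (\int[lebesgue_measure \x lebesgue_measure]_(z in
      `[0%R, (2 * pi)%R] `*` `[0%R, (2 * pi)%R])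
    ohara_integrand j p c z.1 z.2)%E.

(* The endpoint s = 0 is a null set, where the integrand is 0 as above. *)
Definition circle_bound (R : realType) (j p : R) : \bar R :=
  ((2 `^ (3 - j * p) * pi)%R%:E *
   \int[lebesgue_measure]_(s in `[0%R, (pi / 2)%R])
     ((((sin s)%R%:E)^-1 `^ j - (s%:E)^-1 `^ j) `^ p))%E.

Definition round_unit_circle (R : realType) (n : nat)
    (c : R -> 'rV[R]_n) : Prop :=
  exists x0 u v : 'rV[R]_n,
    [/\ enorm u = 1, enorm v = 1, dotv u v = 0 &
        forall t, c t = x0 + cos t *: u + sin t *: v].

(* Main.v *)
Require Import Defs.
From mathcomp Require Import measurable_realfun measurable_fun_approximation ring lra zify.

(* The energy is integrated over shifts t in [0, 2pi] of the slices
   s |-> (1/|c(s+t) - c(s)|^j - 1/d(t)^j)^p.  For fixed t the integrand is a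
   strictly convex decreasing function of the squared chord, so it lies above
   its tangent line at 4 sin(t/2)^2, the squared chord of the circle, and
   Jensen's argument reduces the inequality to the sharp mean chord bound
     int_0^2pi |c(s+t) - c(s)|^2 ds <= 8 pi sin(t/2)^2.
   This bound is the limit of its analogue for the closed N-gons inscribed in c,
   where discrete Fourier analysis diagonalizes both sides and leaves
   |sin(k m w)| sin w <= |sin(k w)| sin(m w) with w = pi/N.  In the equality case
   almost all, hence by continuity all, chords agree with those of the circle,
   which determines c up to isometry. *)

(** The squared chord is the right variable because its mean over s is a quadratic form in c that
    commutes with shifts of s, so Fourier modes diagonalize it. The exponents j and p enter only
    through convexity. The slope of the tangent line depends on t alone, so it comes out of the
    integral over s and meets the sharp mean bound there. For a smooth curve that bound would follow
    from Parseval's identity for c' and |sin(k x)| <= k |sin x|. With inscribed polygons all sums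
    are finite, and all they need from c is that it is closed and 1-Lipschitz. Absolute continuity
    and |c'| = 1 almost everywhere serve to prove this Lipschitz bound. The inequality holds slice
    by slice. The condition j < 2 + 1/p makes the bound finite, and this is what lets equality of
    the two integrals over t force equality of almost all slices. *)

Set Implicit Arguments.
Unset Strict Implicit.
Unset Printing Implicit Defensive.

Local Open Scope classical_set_scope.
Local Open Scope ring_scope.

(** * Trigonometric inequalities *)

Section Trig.
Context {R : realType}.
Implicit Types x : R.

Lemma ler_cos (a b : R) : 0 <= a -> a <= b -> b <= pi -> cos b <= cos a.
Proof.
move=> a0 ab bp; move: ab; rewrite le_eqVlt => /predU1P[->//|ab].
by apply/ltW; rewrite ltr_cos// in_itv/=; apply/andP; split; lra.
Qed.

Lemma sin_lt x : 0 < x -> sin x < x.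
Proof.
have fd (y : R) : is_derive y 1 (fun y : R => y - sin y) (1 - cos y) by apply: is_deriveB.
have fc a b : {within `[a, b], continuous (fun y : R => y - sin y)}.
  by apply: derivable_within_continuous => y _; exact: ex_derive.
have H (a b : R) : 0 <= a -> 0 <= b -> b <= pi -> a < b -> a - sin a < b - sin b.
  move=> a0 b0 bp ab; have [c] := MVT ab (fun y _ => fd y) (fc _ _).
  rewrite in_itv/= => /andP[ac cb] e.
  rewrite -subr_gt0 e mulr_gt0 ?subr_gt0//.
  have <- : cos 0 = 1 :> R by exact: cos0.
  by rewrite ltr_cos ?in_itv/= ?lexx ?pi_ge0//; [exact: le_lt_trans ac|apply/andP; split; lra].
move=> x0; have [xp|px] := leP x pi.
  by have := H 0 x (lexx _) (ltW x0) xp x0; rewrite sin0 subr0 subr_gt0.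
have := @sin_le1 R x; have := @pi_ge2 R; lra.
Qed.

(** One application of the mean value theorem, with 1 - cos c = 2 sin(c/2)^2 <= c^2/2, gives the
    factor 1/2 instead of the sharp 1/6. Later estimates use only the cubic order. *)
Lemma sub_sin_le x : 0 < x -> x - sin x <= x ^+ 3 / 2.
Proof.
move=> x0.
have fd (y : R) : is_derive y 1 (fun y : R => y - sin y) (1 - cos y) by apply: is_deriveB.
have fc a b : {within `[a, b], continuous (fun y : R => y - sin y)}.
  by apply: derivable_within_continuous => y _; exact: ex_derive.
have [c] := MVT x0 (fun y _ => fd y) (fc _ _).
rewrite in_itv/= sin0 !subr0 => /andP[c0 cx] ->.
have c20 : 0 < c / 2 by rewrite divr_gt0.
have : 1 - cos c <= c ^+ 2 / 2.
  have -> : cos c = 1 - 2 * sin (c / 2) ^+ 2.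
    have -> : cos c = cos ((c / 2) *+ 2) by congr cos; rewrite -mulr_natl; field.
    by rewrite cos_mulr2n cos2sin2; ring.
  have := sin_lt c20.
  have : - (c / 2) <= sin (c / 2).
    have [h|h] := leP (c / 2) pi.
      by rewrite (le_trans _ (sin_ge0_pi _))//; [lra|rewrite h ltW].
    have := @sin_geN1 R (c / 2); have := @pi_ge2 R; lra.
  nra.
move=> h.
have -> : x ^+ 3 / 2 = x ^+ 2 / 2 * x by field.
rewrite ler_pM2r//; nra.
Qed.

Lemma sin_lipschitz (a b : R) : `|sin a - sin b| <= `|a - b|.
Proof.
have abs_sin (x : R) : `|sin x| <= `|x|.
  wlog x0 : x / 0 <= x => [H|].
    have [/H//|x0] := leP 0 x.
    by rewrite -[x in leRHS]opprK normrN -(normrN (sin x)) -sinN H// oppr_ge0 ltW.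
  move: x0; rewrite le_eqVlt => /predU1P[<-|x0]; first by rewrite sin0.
  have [xp|px] := leP x pi.
    rewrite !ger0_norm ?(ltW x0)//; first exact: ltW (sin_lt x0).
    by rewrite sin_ge0_pi// xp ltW.
  have h := sin_max x; have h2 := @pi_ge2 R; rewrite (gtr0_norm x0); lra.
have -> : sin a - sin b = 2 * (cos ((a + b) / 2) * sin ((a - b) / 2)).
  have -> : sin a = sin ((a + b) / 2 + (a - b) / 2) by congr sin; field.
  have -> : sin b = sin ((a + b) / 2 - (a - b) / 2) by congr sin; field.
  by rewrite sinD sinB; ring.
rewrite normrM (ger0_norm (ltW _))// normrM.
have -> : `|a - b| = 2 * (1 * `|(a - b) / 2|).
  by rewrite mul1r normrM [`|2^-1|]ger0_norm// mulrC divfK// pnatr_eq0.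
rewrite ler_pM2l//; apply: ler_pM => //; exact: cos_max.
Qed.

Lemma sin_sqr_sub (a b : R) :
  sin b ^+ 2 = sin a ^+ 2 - sin (a + b) * sin (a - b).
Proof.
rewrite sinD sinB.
have -> (u v x y : R) : (u * v + x * y) * (u * v - x * y) = u ^+ 2 * v ^+ 2 - x ^+ 2 * y ^+ 2.
  by ring.
by rewrite (cos2sin2 a) (cos2sin2 b); ring.
Qed.

(** Jordan's inequality, from concavity: [f] vanishes at 0 and pi/2, so a negative value at x would
    give points c1 < c2 with f'(c1) < 0 < f'(c2), while the cosine decreases. *)
Lemma sin_ge_jordan x : 0 <= x <= pi / 2 -> 2 / pi * x <= sin x.
Proof.
move=> /andP[x0 x1]; rewrite leNgt; apply/negP => xlt.
have pi0 := @pi_gt0 R.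
have xneq0 : 0 < x by rewrite lt_neqAle x0 andbT; apply/eqP => xE; move: xlt; rewrite -xE sin0 mulr0 ltxx.
have xlt1 : x < pi / 2.
  rewrite lt_neqAle x1 andbT; apply/eqP => xE; move: xlt; rewrite xE sin_pihalf.
  by rewrite mulrA divfK ?gt_eqF// divff// ltxx.
pose f (y : R) := sin y - 2 / pi * y.
pose df (y : R) := cos y - 2 / pi.
have fd (y : R) : is_derive y 1 f (df y).
  rewrite /f /df; apply: is_deriveB; apply: is_derive_eq; by rewrite ?scaler1//= mulr1.
have fc a b : {within `[a, b], continuous f}.
  apply: derivable_within_continuous => y _; exact: ex_derive.
have [c1 c1i e1] := MVT xneq0 (fun y _ => fd y) (fc _ _).
have [c2 c2i e2] := MVT xlt1 (fun y _ => fd y) (fc _ _).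
move: c1i c2i; rewrite !in_itv/= => /andP[c10 c1x] /andP[xc2 c2p].
have f0 : f 0 = 0 by rewrite /f sin0 mulr0 subr0.
have fp : f (pi / 2) = 0 by rewrite /f sin_pihalf mulrA divfK ?gt_eqF// divff// subrr.
have fx : f x < 0 by rewrite /f subr_lt0.
have d1 : df c1 < 0.
  by move: fx e1; rewrite f0 !subr0 => + e; rewrite e pmulr_llt0.
have d2 : 0 < df c2.
  have : 0 < f (pi / 2) - f x by rewrite fp sub0r oppr_gt0.
  by rewrite e2 pmulr_lgt0 // subr_gt0.
have : cos c2 < cos c1.
  rewrite ltr_cos ?in_itv/= ?(lt_trans c1x)//; apply/andP; split; lra.
move: d1 d2; rewrite /df; lra.
Qed.

(** This says that sin(k x) / sin x decreases on [0, pi/k]. In the addition formula for k + 1 the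
    two terms compare separately: the first by induction and cos b <= cos a, the second by cos(k b)
    <= cos(k a). *)
Lemma sin_natmul_le (a b : R) k : 0 <= a -> a <= b -> a <= pi / 2 ->
  k%:R * b <= pi -> sin (k%:R * b) * sin a <= sin (k%:R * a) * sin b.
Proof.
move=> a0 ab ap; elim: k => [|k IH]; first by rewrite !mul0r sin0 !mul0r.
have b0 : 0 <= b by lra.
have kb : 0 <= k%:R * b by rewrite mulr_ge0.
have ka : 0 <= k%:R * a by rewrite mulr_ge0.
have kab : k%:R * a <= k%:R * b by rewrite ler_wpM2l.
rewrite -[in k.+1]addn1 natrD !mulrDl !mul1r => kp.
have /IH {}IH : k%:R * b <= pi by lra.
have bp : b <= pi by lra.
have sa : 0 <= sin a by apply: sin_ge0_pi; lra.
have sb : 0 <= sin b by apply: sin_ge0_pi; lra.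
have skb : 0 <= sin (k%:R * b) by apply: sin_ge0_pi; lra.
have ca : 0 <= cos a by apply: cos_ge0_pihalf; lra.
have cab : cos b <= cos a by exact: ler_cos.
have ckab : cos (k%:R * b) <= cos (k%:R * a) by apply: ler_cos => //; lra.
rewrite !sinD !mulrDl; apply: lerD.
  apply: (@le_trans _ _ (sin (k%:R * b) * cos a * sin a)).
    by rewrite ler_wpM2r// ler_wpM2l.
  rewrite [leLHS]mulrAC [leRHS]mulrAC; exact: ler_wpM2r.
by rewrite -!mulrA [sin a * _]mulrC ler_wpM2r// mulr_ge0.
Qed.

(* For k m <= N this is [sin_natmul_le]; otherwise the left-hand side is at most
   pi/N and Jordan's inequality bounds the right-hand side below by
   4 k m / N^2. *)
Lemma sin_natmul_le_small (N m k : nat) : (0 < m)%N -> (0 < k)%N ->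
  (2 * m <= N)%N -> (2 * k <= N)%N ->
  `|sin (k%:R * (m%:R * (pi / N%:R) : R))| * sin (pi / N%:R) <=
  sin (k%:R * (pi / N%:R)) * sin (m%:R * (pi / N%:R)).
Proof.
move=> m0 k0 mN kN.
have pi0 := @pi_gt0 R.
have N0 : (0 < N)%N by lia.
have NR : 0 < N%:R :> R by rewrite ltr0n.
set d := pi / N%:R.
have d0 : 0 < d by rewrite divr_gt0.
have Nd : N%:R * d = pi by rewrite /d mulrC divfK// gt_eqF.
have halfb (i : nat) : (2 * i <= N)%N -> i%:R * d <= pi / 2.
  move=> iN; have : (2 * i)%:R * d <= N%:R * d by rewrite ler_pM2r// ler_nat.
  rewrite natrM Nd; lra.
have dp : d <= pi / 2 by rewrite -[leLHS]mul1r; apply: (halfb 1%N); lia.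
have sd : 0 <= sin d by apply: sin_ge0_pi; lra.
have [kmN|kmN] := leqP (k * m) N.
  have kmp : k%:R * (m%:R * d) <= pi by rewrite mulrA -natrM -Nd ler_pM2r// ler_nat.
  rewrite ger0_norm; last first.
    by apply: sin_ge0_pi; rewrite kmp andbT !mulr_ge0// ltW.
  apply: sin_natmul_le => //; first exact: ltW.
  by rewrite -[leLHS]mul1r ler_pM2r// ler1n.
have jor (i : nat) : (2 * i <= N)%N -> 2 / pi * (i%:R * d) <= sin (i%:R * d).
  by move=> /halfb iN; apply: sin_ge_jordan; rewrite iN mulr_ge0// ltW.
have sdd : sin d <= d by exact: ltW (sin_lt d0).
apply: (@le_trans _ _ d).
  by rewrite -[leRHS]mul1r; apply: ler_pM => //; exact: sin_max.
apply: (@le_trans _ _ ((2 / pi * (k%:R * d)) * (2 / pi * (m%:R * d)))); last first.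
  apply: ler_pM (jor _ kN) (jor _ mN);
  by rewrite !mulr_ge0 ?invr_ge0// ltW.
have km : N%:R <= (k * m)%:R :> R by rewrite ler_nat ltnW.
have -> : 2 / pi * (k%:R * d) * (2 / pi * (m%:R * d)) =
   4 / pi * ((k * m)%:R * d / pi) * d by rewrite natrM; field; lra.
have h1 : 1 <= (k * m)%:R * d / pi by rewrite ler_pdivlMr// mul1r -Nd ler_pM2r.
have pi4 : 1 <= 4 / pi :> R.
  rewrite ler_pdivlMr// mul1r; have := @pihalf_lt2 R; lra.
have h41 := ler_pM ler01 ler01 pi4 h1; rewrite mulr1 in h41.
by rewrite -[leLHS]mul1r ler_pM2r.
Qed.

Lemma sin_natDpi (k : nat) (x : R) : `|sin (x + k%:R * pi)| = `|sin x|.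
Proof.
elim: k => [|k IH]; first by rewrite mul0r addr0.
by rewrite -natr1 mulrDl mul1r addrA sinDpi normrN.
Qed.

Lemma sin_reflect (N k m : nat) : (0 < N)%N -> (k <= N)%N ->
  `|sin ((N - k)%:R * (m%:R * (pi / N%:R)))| = `|sin (k%:R * (m%:R * (pi / N%:R) : R))|.
Proof.
move=> N0 kN; rewrite -[in RHS]normrN -sinN -[RHS](sin_natDpi m).
congr (`|sin _|); rewrite natrB//; field.
by rewrite pnatr_eq0 -lt0n.
Qed.

(* Both sides are invariant under k -> N - k and m -> N - m, which reduces the
   claim to k, m <= N/2. *)
Lemma sin_natmul_sqr_le (N m k : nat) : (m <= N)%N -> (k < N)%N ->
  sin (k%:R * (m%:R * (pi / N%:R)) : R) ^+ 2 * sin (pi / N%:R) ^+ 2 <=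
  sin (k%:R * (pi / N%:R)) ^+ 2 * sin (m%:R * (pi / N%:R)) ^+ 2.
Proof.
move=> mN kN; have N0 : (0 < N)%N by lia.
have NR : N%:R != 0 :> R by rewrite pnatr_eq0 -lt0n.
have [->|k0] := posnP k; first by rewrite !mul0r sin0 expr0n/= !mul0r.
have [->|m0] := posnP m; first by rewrite mul0r mulr0 sin0 expr0n/= !(mul0r, mulr0).
(* The reflection sends m = N to 0, which [sin_natmul_le_small] excludes; here both sides vanish. *)
have [->|m1] := eqVneq m N.
  have -> : N%:R * (pi / N%:R) = pi :> R by rewrite mulrC divfK.
  have -> : sin (k%:R * pi : R) = 0.
    by apply/eqP; rewrite -normr_eq0 -[_ * _]add0r sin_natDpi sin0 normr0.
  by rewrite sinpi expr0n/= mul0r mulr0.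
pose k' := if (2 * k <= N)%N then k else (N - k)%N.
pose m' := if (2 * m <= N)%N then m else (N - m)%N.
have k'0 : (0 < k')%N by rewrite /k'; case: ifP; lia.
have m'0 : (0 < m')%N by rewrite /m'; case: ifP; lia.
have k'N : (2 * k' <= N)%N by rewrite /k'; case: ifP; lia.
have m'N : (2 * m' <= N)%N by rewrite /m'; case: ifP; lia.
have sk (y : nat) : `|sin (k%:R * (y%:R * (pi / N%:R)) : R)| = `|sin (k'%:R * (y%:R * (pi / N%:R)))|.
  by rewrite /k'; case: ifP => // _; rewrite sin_reflect// ltnW.
have sm (y : nat) : `|sin (y%:R * (m%:R * (pi / N%:R)) : R)| = `|sin (y%:R * (m'%:R * (pi / N%:R)))|.
  rewrite /m'; case: ifP => // _.
  by rewrite [in LHS]mulrCA [in RHS]mulrCA sin_reflect// ltnW.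
have := sin_natmul_le_small m'0 k'0 m'N k'N.
rewrite -(ler_sqr (x := `|_| * _)) ?nnegrE; last 2 first.
- rewrite mulr_ge0//; apply: sin_ge0_pi; rewrite divr_ge0 ?pi_ge0//=.
  by rewrite ler_pdivrMr ?ltr0n// ler_peMr ?pi_ge0// ler1n.
- rewrite (le_trans _ (sin_natmul_le_small m'0 k'0 m'N k'N))// mulr_ge0//.
  apply: sin_ge0_pi; rewrite divr_ge0 ?pi_ge0//=.
  by rewrite ler_pdivrMr ?ltr0n// ler_peMr ?pi_ge0// ler1n.
rewrite !exprMn.
have sqE (u v : R) : `|u| = `|v| -> u ^+ 2 = v ^+ 2.
  by move=> e; rewrite -[LHS]real_normK ?num_real// e real_normK ?num_real.
rewrite real_normK ?num_real//.
rewrite -(sqE _ _ (sm k')) -(sqE _ _ (sk m)).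
have := sk 1%N; rewrite !mul1r => /sqE <-.
by have := sm 1%N; rewrite !mul1r => /sqE <-.
Qed.

End Trig.

(** * Discrete Fourier transform *)

Section DFT.
Context {R : realType}.
Variable N : nat.
Hypothesis N0 : (0 < N)%N.
(** Half the angular step 2 pi/N, because a chord of angle 2x on the unit circle has length 2 sin
    x. *)
Let w : R := pi / N%:R.

Let Nw : N%:R * w = pi.
Proof. by rewrite /w mulrC divfK// pnatr_eq0 -lt0n. Qed.

Let sin2pin (k : nat) (x : R) : sin (x + k%:R * (2 * pi)) = sin x.
Proof.
elim: k => [|k IH]; first by rewrite mul0r addr0.
by rewrite -natr1 mulrDl mul1r addrA (mulr_natl pi) sinD2pi -(mulr_natl pi).
Qed.

Let cos2pin (k : nat) (x : R) : cos (x + k%:R * (2 * pi)) = cos x.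
Proof.
elim: k => [|k IH]; first by rewrite mul0r addr0.
by rewrite -natr1 mulrDl mul1r addrA (mulr_natl pi) cosD2pi -(mulr_natl pi).
Qed.

(** Multiplied by 2 sin(r w), which is nonzero for 0 < r < N, the sum telescopes, and its two end
    terms agree by periodicity. *)
Lemma sum_cos_eq0 (r : nat) : (0 < r < N)%N ->
  \sum_(i < N) cos (i%:R * (r%:R * (2 * w))) = 0.
Proof.
move=> /andP[r0 rN].
have w0 : 0 < w by rewrite divr_gt0 ?pi_gt0// ltr0n.
have s0 : sin (r%:R * w) != 0.
  rewrite gt_eqF//; apply: sin_gt0_pi; rewrite mulr_gt0 ?ltr0n//=.
  by rewrite -Nw ltr_pM2r// ltr_nat.
apply/eqP; rewrite -(mulIr_eq0 _ (mulIf s0)) -(mulIr_eq0 _ (@mulIf _ 2 _)) ?pnatr_eq0//.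
rewrite !mulr_suml.
under eq_bigr => i _.
  rewrite (_ : _ * 2 = sin ((i.+1%:R * 2 - 1) * (r%:R * w)) - sin ((i%:R * 2 - 1) * (r%:R * w))); last first.
    rewrite (_ : (i.+1%:R * 2 - 1) * (r%:R * w) = i%:R * (r%:R * (2 * w)) + r%:R * w); last by rewrite -natr1; ring.
    rewrite (_ : (i%:R * 2 - 1) * (r%:R * w) = i%:R * (r%:R * (2 * w)) - r%:R * w); last by ring.
    by rewrite sinD sinB; ring.
  over.
rewrite -(big_mkord xpredT (fun i => sin ((i.+1%:R * 2 - 1) * (r%:R * w)) - sin ((i%:R * 2 - 1) * (r%:R * w)))).
rewrite telescope_sumr//.
rewrite (_ : (N%:R * 2 - 1) * (r%:R * w) = - (r%:R * w) + r%:R * (2 * pi)); last by rewrite -Nw; ring.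
by rewrite sin2pin mul0r sub0r mulN1r subrr.
Qed.

Lemma sum_cos_delta (k l : 'I_N) :
  \sum_(i < N) cos (i%:R * (k%:R * (2 * w)) - i%:R * (l%:R * (2 * w))) = N%:R * (k == l)%:R.
Proof.
have [->|kl] := eqVneq k l.
  under eq_bigr do rewrite subrr cos0.
  by rewrite sumr_const card_ord mulr1.
rewrite mulr0; wlog klt : k l kl / (l < k)%N => [H|].
  have [/H->//|] := ltnP l k.
  rewrite leq_eqVlt (inj_eq val_inj) (negbTE kl)/= => lk.
  rewrite -[RHS](H l k)// 1?eq_sym//.
  by apply: eq_bigr => i _; rewrite -cosN opprB.
have rN : (0 < k - l < N)%N by have := ltn_ord k; lia.
rewrite -[RHS](sum_cos_eq0 rN); apply: eq_bigr => i _.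
by congr cos; rewrite natrB 1?ltnW//; ring.
Qed.

(** With [dft_sin], the real and imaginary parts of sum_k x_k z^(i k), where z is the primitive N-th
    root of unity of angle 2w. *)
Definition dft_cos (x : nat -> R) (i : nat) := \sum_(k < N) x k * cos (i%:R * (k%:R * (2 * w))).
Definition dft_sin (x : nat -> R) (i : nat) := \sum_(k < N) x k * sin (i%:R * (k%:R * (2 * w))).

Lemma dft_parseval (x : nat -> R) :
  \sum_(i < N) (dft_cos x i ^+ 2 + dft_sin x i ^+ 2) = N%:R * \sum_(k < N) x k ^+ 2.
Proof.
transitivity (\sum_(i < N) \sum_(k < N) \sum_(l < N)
   x k * x l * cos (i%:R * (k%:R * (2 * w)) - i%:R * (l%:R * (2 * w)))).
  apply: eq_bigr => i _; rewrite !expr2 /dft_cos /dft_sin !mulr_suml -big_split/=.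
  apply: eq_bigr => k _; rewrite !mulr_sumr -big_split/=; apply: eq_bigr => l _.
  by rewrite cosB; ring.
rewrite exchange_big mulr_sumr; apply: eq_bigr => k _.
rewrite exchange_big/= (bigD1 k)//= [X in _ + X]big1 => [|l lk].
  by rewrite addr0 -mulr_sumr sum_cos_delta eqxx mulr1 expr2 mulrC.
by rewrite -mulr_sumr sum_cos_delta eq_sym (negbTE lk) !mulr0.
Qed.

Lemma sum_periodic_shift (V : zmodType) (y : nat -> V) m : (forall k, y (k + N)%N = y k) ->
  \sum_(k < N) y (k + m)%N = \sum_(k < N) y k.
Proof.
move=> yN; elim: m => [|m IH]; first by under eq_bigr do rewrite addn0.
rewrite -IH; have -> : \sum_(k < N) y (k + m.+1)%N = \sum_(k < N.+1) y (k + m)%N - y m.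
  rewrite big_ord_recl add0n addrC addKr; apply: eq_bigr => k _.
  by rewrite lift0 addnS addSn.
by rewrite big_ord_recr/= [(N + m)%N]addnC yN addrK.
Qed.

(** With [dft_sin_shift]: a shift by m rotates the pair ([dft_cos], [dft_sin]) at frequency i by the
    angle -2 i m w. *)
Lemma dft_cos_shift (x : nat -> R) m i : (forall k, x (k + N)%N = x k) ->
  dft_cos (fun k => x (k + m)%N) i =
  cos (i%:R * (m%:R * (2 * w))) * dft_cos x i + sin (i%:R * (m%:R * (2 * w))) * dft_sin x i.
Proof.
move=> xN; rewrite /dft_cos /dft_sin !mulr_sumr -big_split/=.
transitivity (\sum_(k < N) x k * cos (i%:R * (k%:R * (2 * w)) - i%:R * (m%:R * (2 * w)))); last first.
  by apply: eq_bigr => k _; rewrite cosB; ring.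
rewrite -(sum_periodic_shift m (y := fun k => x k * cos (i%:R * (k%:R * (2 * w)) - i%:R * (m%:R * (2 * w))))); last first.
  move=> k; rewrite xN; congr (_ * _); rewrite -[RHS](cos2pin i); congr cos.
  by rewrite -Nw natrD; ring.
by apply: eq_bigr => k _; congr (_ * cos _); rewrite natrD; ring.
Qed.

Lemma dft_sin_shift (x : nat -> R) m i : (forall k, x (k + N)%N = x k) ->
  dft_sin (fun k => x (k + m)%N) i =
  cos (i%:R * (m%:R * (2 * w))) * dft_sin x i - sin (i%:R * (m%:R * (2 * w))) * dft_cos x i.
Proof.
move=> xN; rewrite /dft_cos /dft_sin !mulr_sumr -sumrB/=.
transitivity (\sum_(k < N) x k * sin (i%:R * (k%:R * (2 * w)) - i%:R * (m%:R * (2 * w)))); last first.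
  by apply: eq_bigr => k _; rewrite sinB; ring.
rewrite -(sum_periodic_shift m (y := fun k => x k * sin (i%:R * (k%:R * (2 * w)) - i%:R * (m%:R * (2 * w))))); last first.
  move=> k; rewrite xN; congr (_ * _); rewrite -[RHS](sin2pin i); congr sin.
  by rewrite -Nw natrD; ring.
by apply: eq_bigr => k _; congr (_ * sin _); rewrite natrD; ring.
Qed.

(** A difference of step m multiplies the i-th coefficient by a rotation minus the identity, whose
    squared modulus is 4 sin(i m w)^2. *)
Lemma dft_norm_shift (x : nat -> R) m i : (forall k, x (k + N)%N = x k) ->
  dft_cos (fun k => x (k + m)%N - x k) i ^+ 2 + dft_sin (fun k => x (k + m)%N - x k) i ^+ 2
  = 4 * sin (i%:R * (m%:R * w)) ^+ 2 * (dft_cos x i ^+ 2 + dft_sin x i ^+ 2).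
Proof.
move=> xN.
have -> : dft_cos (fun k => x (k + m)%N - x k) i = dft_cos (fun k => x (k + m)%N) i - dft_cos x i.
  by rewrite /dft_cos -sumrB; apply: eq_bigr => k _; rewrite mulrBl.
have -> : dft_sin (fun k => x (k + m)%N - x k) i = dft_sin (fun k => x (k + m)%N) i - dft_sin x i.
  by rewrite /dft_sin -sumrB; apply: eq_bigr => k _; rewrite mulrBl.
rewrite dft_cos_shift// dft_sin_shift//.
have -> : i%:R * (m%:R * (2 * w)) = (i%:R * (m%:R * w)) *+ 2 by rewrite -mulr_natl; ring.
rewrite sin_mulr2n cos_mulr2n.
set t := i%:R * (m%:R * w); have := cos2Dsin2 t.
set S := sin t; set C := cos t; set A := dft_cos _ _; set B := dft_sin _ _ => e.
have -> : C ^+ 2 = 1 - S ^+ 2 by rewrite -e addrK.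
transitivity (4 * S ^+ 2 * (A ^+ 2 + B ^+ 2) * (C ^+ 2 + S ^+ 2)); first by ring.
by rewrite e mulr1.
Qed.

(** The constant is sharp: frequency 1, that is the regular N-gon, gives equality. *)
Lemma discrete_wirtinger (x : nat -> R) m : (m <= N)%N -> (forall k, x (k + N)%N = x k) ->
  sin w ^+ 2 * \sum_(k < N) (x (k + m)%N - x k) ^+ 2 <=
  sin (m%:R * w) ^+ 2 * \sum_(k < N) (x k.+1 - x k) ^+ 2.
Proof.
move=> mN xN.
have NR : 0 < N%:R :> R by rewrite ltr0n.
rewrite -(ler_pM2l NR) ![N%:R * (_ * _)]mulrCA.
have -> : \sum_(k < N) (x k.+1 - x k) ^+ 2 = \sum_(k < N) (x (k + 1)%N - x k) ^+ 2.
  by apply: eq_bigr => k _; rewrite addn1.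
rewrite -(dft_parseval (fun k => x (k + m)%N - x k)) -(dft_parseval (fun k => x (k + 1)%N - x k)).
rewrite !mulr_sumr ler_sum// => i _.
rewrite !dft_norm_shift//.
have := @sin_natmul_sqr_le R N m i mN (ltn_ord i); rewrite -/w mul1r.
set Q := _ + _ => H.
have Q0 : 0 <= Q by rewrite addr_ge0 ?sqr_ge0.
have -> (u v : R) : u * (4 * v * Q) = (v * u) * (4 * Q) by ring.
have -> (u v : R) : u * (4 * v * Q) = (v * u) * (4 * Q) by ring.
by rewrite ler_wpM2r// mulr_ge0.
Qed.

End DFT.

(** * Arclength-parametrized curves *)

Section Euclid.
Context {R : realType} {n : nat}.
Implicit Types x y z : 'rV[R]_n.

Lemma dotvC x y : dotv x y = dotv y x.
Proof. by apply: eq_bigr => i _; rewrite mulrC. Qed.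

Lemma dotvDl x y z : dotv (x + y) z = dotv x z + dotv y z.
Proof. by rewrite -big_split; apply: eq_bigr => i _; rewrite mxE mulrDl. Qed.

Lemma dotvZl a x z : dotv (a *: x) z = a * dotv x z.
Proof. by rewrite /dotv mulr_sumr; apply: eq_bigr => i _; rewrite mxE mulrA. Qed.

Lemma dotvNl x z : dotv (- x) z = - dotv x z.
Proof. by rewrite -scaleN1r dotvZl mulN1r. Qed.

Lemma dotvDr x y z : dotv z (x + y) = dotv z x + dotv z y.
Proof. by rewrite dotvC dotvDl !(dotvC z). Qed.

Lemma dotvZr a x z : dotv z (a *: x) = a * dotv z x.
Proof. by rewrite dotvC dotvZl (dotvC z). Qed.

Lemma dotvNr x z : dotv z (- x) = - dotv z x.
Proof. by rewrite dotvC dotvNl (dotvC z). Qed.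

Lemma dotv_sqrD x y :
  dotv (x + y) (x + y) = dotv x x + 2 * dotv x y + dotv y y.
Proof. by rewrite !(dotvDl, dotvDr) (dotvC y x); ring. Qed.

Lemma dotv_sqrB x y :
  dotv (x - y) (x - y) = dotv x x - 2 * dotv x y + dotv y y.
Proof. by rewrite dotv_sqrD dotvNr dotvNl dotvNr; ring. Qed.

Lemma dotv_ge0 x : 0 <= dotv x x.
Proof. by apply: sumr_ge0 => i _; rewrite -expr2 sqr_ge0. Qed.

Lemma dotv_eq0 x : dotv x x = 0 -> x = 0.
Proof.
move=> /eqP; rewrite psumr_eq0 => [/allP H|i _]; last by rewrite -expr2 sqr_ge0.
apply/rowP => i; rewrite mxE; apply/eqP.
by have := H i (mem_index_enum _); rewrite -expr2 sqrf_eq0.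
Qed.

Lemma enorm_ge0 x : 0 <= enorm x. Proof. exact: sqrtr_ge0. Qed.

Lemma sqr_enorm x : enorm x ^+ 2 = dotv x x.
Proof. by rewrite sqr_sqrtr// dotv_ge0. Qed.

Lemma enorm_eq0 x : enorm x = 0 -> x = 0.
Proof. by move=> e; apply: dotv_eq0; rewrite -sqr_enorm e expr0n. Qed.

Lemma enorm0 : enorm (0 : 'rV[R]_n) = 0.
Proof. by rewrite /enorm -(scale0r 0) dotvZl mul0r sqrtr0. Qed.

Lemma enormZ a x : enorm (a *: x) = `|a| * enorm x.
Proof. by rewrite /enorm dotvZl dotvZr mulrA -expr2 sqrtrM ?sqr_ge0// sqrtr_sqr. Qed.

Lemma enormN x : enorm (- x) = enorm x.
Proof. by rewrite -scaleN1r enormZ normrN1 mul1r. Qed.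

Lemma enormB x y : enorm (x - y) = enorm (y - x).
Proof. by rewrite -enormN opprB. Qed.

Lemma cauchy_schwarz x y : dotv x y <= enorm x * enorm y.
Proof.
have [/enorm_eq0 ->|x0] := eqVneq (enorm x) 0.
  by rewrite enorm0 -(scale0r 0) dotvZl !mul0r.
have [/enorm_eq0 ->|y0] := eqVneq (enorm y) 0.
  by rewrite enorm0 -(scale0r 0) dotvZr mul0r mulr0.
have xy0 : 0 < enorm x * enorm y by rewrite mulr_gt0// lt_def ?x0 ?y0 enorm_ge0.
have := dotv_ge0 (enorm y *: x - enorm x *: y).
rewrite !(dotvDl, dotvDr, dotvNl, dotvNr, dotvZl, dotvZr) -!sqr_enorm (dotvC y x).
set a := enorm x; set b := enorm y; set d := dotv x y => H.
rewrite -(ler_pM2l xy0) -/a -/b; nra.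
Qed.

Lemma enorm_triangle x y : enorm (x + y) <= enorm x + enorm y.
Proof.
rewrite -ler_sqr ?nnegrE ?addr_ge0 ?enorm_ge0// sqr_enorm sqrrD !sqr_enorm.
rewrite !(dotvDl, dotvDr) (dotvC y x); have := cauchy_schwarz x y; lra.
Qed.

Lemma enorm_triangleB x y z : enorm (x - z) <= enorm (x - y) + enorm (y - z).
Proof. by rewrite (_ : x - z = (x - y) + (y - z)) ?enorm_triangle// addrA subrK. Qed.

Lemma continuous_enorm : continuous (@enorm R n).
Proof.
move=> x; apply: (@continuous_comp _ _ _ (fun x => dotv x x) Num.sqrt); last exact: sqrt_continuous.
have sq i : continuous (fun x : 'rV[R]_n => x 0 i * x 0 i).
  by move=> y; apply: continuousM; exact: coord_continuous.
by apply: continuous_big => [|i _]; [exact: add_continuous|exact: sq].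
Qed.

End Euclid.

Lemma negligible_open_cover {R : realType} (E : set R) (d : R) :
  lebesgue_measure.-negligible E -> 0 < d ->
  exists U : set R, [/\ open U, E `<=` U & (lebesgue_measure U < d%:E)%E].
Proof.
move=> [A [mA A0 EA]] d0.
have [|//|U [oU AU UA]] := @lebesgue_regularity_outer R A d mA.
  by apply: le_lt_trans (ltry 0); rewrite le_eqVlt; apply/orP; left; apply/eqP.
have mU : measurable U by exact: measurable_realfun.open_measurable.
exists U; split => //; first exact: subset_trans AU.
apply: le_lt_trans UA; rewrite -[leRHS]adde0 -A0.
rewrite -{1}(setDKU AU).
exact: (@measureU2 _ _ _ (@lebesgue_measure R) (U `\` A) A (measurableD mU mA) mA).
Qed.

(** * From a derivative bound almost everywhere to a Lipschitz bound *)

Section AC.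
Context {R : realType} {n : nat}.
Variables (a b : R) (f : R -> 'rV[R]_n).
Hypothesis ab : a <= b.

(* Replaces the choice of a tagged partition of [a, b] subordinate to a gauge. *)
Lemma cousin_induction (P : R -> Prop) (step : R -> R -> Prop) : P a ->
  (forall x y, a <= x -> x <= y -> y <= b -> P x -> step x y -> P y) ->
  (forall x, a <= x <= b -> exists2 r, 0 < r &
     forall y z, y <= x <= z -> x - r < y -> z < x + r -> step y z) ->
  P b.
Proof.
move=> Pa Pstep H.
pose S := [set x | a <= x <= b /\ P x].
have Sa : S a by split => //; rewrite lexx.
have ubS : ubound S b by move=> x [/andP[]].
have supS : has_sup S by split; [exists a|exists b].
set s := sup S.
have as_ : a <= s by apply: ub_le_sup => //; exists b.
have sb : s <= b by apply: ge_sup => //; exists a.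
have [r r0 sr] := H s (introT andP (conj as_ sb)).
have [y [/andP[ay yb] Py] sy] := sup_adherent r0 supS.
have ys : y <= s by apply: ub_le_sup; [exists b|split; rewrite ?ay].
have Ps : P s by apply: (Pstep y) => //; apply: sr; rewrite ?ys ?lexx//; rewrite ltrDl.
move: sb; rewrite le_eqVlt => /predU1P[<-//|sb].
pose z := Num.min b (s + r / 2).
have sz : s < z by rewrite lt_min sb/= ltrDl divr_gt0.
have zb : z <= b by rewrite ge_min lexx.
have zr : z < s + r by rewrite gt_min; apply/orP; right; lra.
have Pz : P z.
  apply: (Pstep s) => //; first exact: ltW.
  by apply: sr => //; rewrite ?lexx ?(ltW sz)// ltrBlDr ltrDl.
have : z <= s by apply: ub_le_sup; [exists b|split => //; rewrite zb (le_trans as_)// ltW].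
by rewrite leNgt sz.
Qed.

Hypothesis fAC : abs_continuous a b f.
Variable E : set R.
Hypothesis E0 : lebesgue_measure.-negligible E.
Hypothesis fE : forall x, ~ E x -> forall e, 0 < e ->
  exists2 r, 0 < r & forall y, `|y - x| < r -> enorm (f y - f x) <= (1 + e) * `|y - x|.

(* A gauge-fine partition of [a, b] splits into intervals tagged outside E, on
   which f is (1 + e)-Lipschitz at the tag, and intervals tagged in E, which can
   be kept inside an open set of measure less than the d given by absolute
   continuity. *)
Lemma ac_lipschitz : enorm (f b - f a) <= b - a.
Proof.
apply/ler_addgt0Pr => e0 e00.
(* The tagged intervals outside E will cost e (b - a) and those in E will cost e, in total [e0]. *)
pose e := e0 / (b - a + 1).
have ba0 : 0 < b - a + 1 by rewrite ltr_wpDl// subr_ge0.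
have e_gt0 : 0 < e by rewrite divr_gt0.
suff : enorm (f b - f a) <= (1 + e) * (b - a) + e.
  move/le_trans; apply; rewrite mulrDl mul1r -addrA lerD2l.
  by rewrite -[X in _ + X]mulr1 -mulrDr /e divfK// gt_eqF.
have [d d0 fd] := fAC e_gt0.
have [U [oU EU UA]] := negligible_open_cover E0 d0.
have mU : measurable U by exact: measurable_realfun.open_measurable.
(* A partial partition of [a, x]: [I] lists only the intervals kept inside [U], while those with a
   Lipschitz estimate are already absorbed in (1 + e) (x - a). *)
pose P x := exists m (I : 'I_m -> R * R),
  [/\ forall k, [/\ a <= (I k).1, (I k).1 <= (I k).2, (I k).2 <= x &
         `](I k).1, (I k).2[ `<=` U],
      trivIset setT (fun k => `](I k).1, (I k).2[%classic) &
      enorm (f x - f a) <= (1 + e) * (x - a) + \sum_(k < m) enorm (f (I k).2 - f (I k).1)].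
suff [m [I [IU tI]]] : P b.
  move=> /le_trans; apply; rewrite lerD2l ltW//; apply: fd => //.
    by move=> k; have [] := IU k.
  rewrite -lte_fin; apply: le_lt_trans UA.
  have mI k : measurable [set` `](I k).1, (I k).2[] by exact: measurable_itv.
  have mUI : measurable (\big[setU/set0]_(k < m) `](I k).1, (I k).2[%classic).
    exact: bigsetU_measurable.
  apply: (@le_trans _ _ (lebesgue_measure (\big[setU/set0]_(k < m) `](I k).1, (I k).2[%classic))).
    rewrite measure_semi_additive_ord// -sumEFin lee_sum// => k _.
    suff : (((I k).2 - (I k).1)%:E <= lebesgue_measure `](I k).1, (I k).2[%classic)%E by [].
    rewrite lebesgue_measure_itv/= lte_fin; case: ifPn => //.
    by rewrite -leNgt lee_fin subr_le0.
  apply: le_measure; rewrite ?inE//.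
  apply: (big_ind (fun A => A `<=` U)) => [//|A B AU BU x [/AU|/BU]//|k _].
  by have [] := IU k.
pose step (y z : R) := enorm (f z - f y) <= (1 + e) * (z - y) \/ `]y, z[ `<=` U.
apply: (@cousin_induction P step).
- exists 0%N, (fun=> (0, 0)); split; [by case|by move=> []|].
  by rewrite !subrr enorm0 mulr0 big_ord0 addr0.
- move=> x y ax xy yb [m [I [IU tI Ix]]] [st|st].
    exists m, I; split => //.
      by move=> k; have [? ? ? ?] := IU k; split => //; exact: le_trans xy.
    rewrite (le_trans (enorm_triangleB _ (f x) _))//.
    by move: st Ix; set T := \sum_(k < m) _; lra.
  pose J (k : 'I_m.+1) := if unlift ord_max k is Some k' then I k' else (x, y).
  exists m.+1, J; split.
  + move=> k; rewrite /J; case: unliftP => [k' _|_]; last by split.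
    by have [? ? ? ?] := IU k'; split => //; exact: le_trans xy.
  + move=> k l _ _; rewrite /J.
    case: unliftP => [k' ->|->]; case: unliftP => [l' ->|->] //.
    * by move=> /tI ->.
    * move=> [z []]; have [_ _ k1 _] := IU k'.
      rewrite /= !in_itv/= => /andP[_ zk] /andP[xz _].
      by have := lt_le_trans zk k1; rewrite ltNge (ltW xz).
    * move=> [z []]; have [_ _ k1 _] := IU l'.
      rewrite /= !in_itv/= => /andP[xz _] /andP[_ zk].
      by have := lt_le_trans zk k1; rewrite ltNge (ltW xz).
  + have Jmax : J ord_max = (x, y) by rewrite /J unlift_none.
    rewrite big_ord_recr/= Jmax/=.
    under eq_bigr => k _.
      rewrite (_ : J _ = I k); last first.
        rewrite /J (_ : widen_ord _ k = lift ord_max k) ?liftK//.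
        by apply: val_inj; rewrite /= /bump leqNgt ltn_ord.
      over.
    rewrite (le_trans (enorm_triangleB _ (f x) _))//.
    have : 0 <= e * (y - x) by rewrite mulr_ge0 ?subr_ge0// ltW.
    move: Ix; set T := \sum_(k < m) _; lra.
- move=> x /andP[ax xb].
  have [Ex|nEx] := pselect (E x).
    have Ux : U x by exact: EU.
    have /nbhs_ballP[r/= r0 rU] : nbhs x U by exact: open_nbhs_nbhs.
    exists r => // y z /andP[yx xz] yr zr; right => t.
    rewrite /= in_itv/= => /andP[yt tz]; apply: rU.
    by rewrite /ball/= ltr_norml; lra.
  have [r r0 fr] := fE nEx e_gt0.
  exists r => // y z /andP[yx xz] yr zr; left.
  rewrite (le_trans (enorm_triangleB _ (f x) _))//.
  have hz : enorm (f z - f x) <= (1 + e) * (z - x).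
    by rewrite -[z - x]ger0_norm ?subr_ge0//; apply: fr; rewrite ger0_norm ?subr_ge0//; lra.
  have hy : enorm (f x - f y) <= (1 + e) * (x - y).
    rewrite enormB -[x - y]ger0_norm ?subr_ge0// distrC; apply: fr.
    by rewrite distrC ger0_norm ?subr_ge0//; lra.
  lra.
Qed.

End AC.

Section Curve.
Context {R : realType} {n : nat}.
Variable c : R -> 'rV[R]_n.
Hypothesis hc : closed_unit_speed_curve c.

Lemma curve_periodicz (k : int) t : c (t + 2 * pi * k%:~R) = c t.
Proof.
have [cp _ _] := hc.
have cpn (m : nat) x : c (x + 2 * pi * m%:R) = c x.
  by elim: m => [|m IH]; rewrite ?mulr0 ?addr0// -[in m.+1%:R]natr1 mulrDr mulr1 addrA cp.
case: k => m; first by rewrite -pmulrn cpn.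
by rewrite NegzE mulrNz mulrN -[RHS](cpn m.+1 t) -[in RHS](subrK (2 * pi * m.+1%:R) t) cpn cpn.
Qed.

Lemma curve_lipschitz_period a b : 0 <= a -> a <= b -> b <= 2 * pi ->
  enorm (c b - c a) <= b - a.
Proof.
have [cp cac cd] := hc => a0 ab b2.
apply: (ac_lipschitz ab) => //.
- move=> e e0; have [d d0 H] := cac e e0; exists d => // m I HI; apply: H => k.
  by have [? [? ?]] := HI k; split; [exact: le_trans a0 _|split => //; exact: le_trans b2].
- exact: cd.
- move=> x /contrapT [dx ux] e e0.
  have : enorm (h^-1 *: ((c \o shift x) (h *: 1) - c x)) @[h --> 0^'] --> enorm ('D_1 c x).
    by apply: (@cvg_comp _ _ _ _ (@enorm R n) _ _ _ dx); exact: continuous_enorm.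
  rewrite ux.
  have e1 : (1 : R) < 1 + e by rewrite ltrDl.
  move=> /cvgr_lt /(_ _ e1).
  rewrite near_withinE => /nbhs_ballP[r /= r0 rH].
  exists r => // y yr.
  have [->|yx] := eqVneq y x; first by rewrite !subrr enorm0 normr0 mulr0.
  have yx0 : 0 < `|y - x| by rewrite normr_gt0 subr_eq0.
  have := rH (y - x); rewrite /ball/= sub0r normrN => /(_ yr).
  rewrite subr_eq0 => /(_ yx); rewrite enormZ normfV /shift/= [_ *: 1]mulr1 subrK.
  by rewrite ltr_pdivrMl// mulrC => /ltW.
Qed.

(** The bound is known within one period. Intervals in the nonnegative half-line are cut at
    multiples of 2 pi by induction, and a shift by k periods makes t nonnegative. *)
Lemma curve_lipschitz s t : enorm (c s - c t) <= `|s - t|.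
Proof.
wlog st : s t / t <= s => [H|].
  by have [/H//|/ltW/H] := leP t s; rewrite enormB distrC.
rewrite ger0_norm ?subr_ge0//.
have P0 : 0 < 2 * pi :> R by rewrite mulr_gt0 ?pi_gt0.
have pos (m : nat) : forall a b, 0 <= a -> a <= b -> b <= 2 * pi * m%:R ->
    enorm (c b - c a) <= b - a.
  elim: m => [|m IH] a b a0 ab.
    rewrite mulr0 => b0; have -> : a = b by lra.
    by rewrite !subrr enorm0.
  rewrite -[in m.+1%:R]natr1 mulrDr mulr1 => bm.
  have step a' b' : 2 * pi * m%:R <= a' -> a' <= b' -> b' <= 2 * pi * m%:R + 2 * pi ->
      enorm (c b' - c a') <= b' - a'.
    move=> a'0 ab' b'm.
    have := @curve_lipschitz_period (a' - 2 * pi * m%:R) (b' - 2 * pi * m%:R).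
    have e x : c (x - 2 * pi * m%:R) = c x.
      by rewrite -[RHS](curve_periodicz (- m%:Z)) mulrNz mulrN.
    rewrite !e => H; apply: le_trans (H _ _ _) _; lra.
  have [bm'|mb] := leP b (2 * pi * m%:R); first exact: IH.
  have [am|ma] := leP a (2 * pi * m%:R).
    apply: le_trans (enorm_triangleB _ (c (2 * pi * m%:R)) _) _.
    have h1 := IH _ _ a0 am (lexx _).
    have h2 := step _ _ (lexx _) (ltW mb) bm.
    lra.
  exact: step (ltW ma) _ _.
pose k := (Num.truncn (`|t| / (2 * pi))).+1.
have tk : 0 <= t + 2 * pi * k%:R.
  have : `|t| / (2 * pi) < k%:R by rewrite truncnS_gt.
  rewrite ltr_pdivrMr// => h; have := ler_norm (- t); rewrite normrN => h2.
  rewrite -[_ * k%:R]mulrC; lra.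
pose m := (Num.truncn (`|s + 2 * pi * k%:R| / (2 * pi))).+1.
have := pos m (t + 2 * pi * k%:R) (s + 2 * pi * k%:R) tk.
rewrite lerD2r st => /(_ isT).
have -> : c (t + 2 * pi * k%:R) = c t by exact: (curve_periodicz k).
have -> : c (s + 2 * pi * k%:R) = c s by exact: (curve_periodicz k).
have -> : s + 2 * pi * k%:R - (t + 2 * pi * k%:R) = s - t by ring.
apply.
have : `|s + 2 * pi * k%:R| / (2 * pi) < m%:R by rewrite truncnS_gt.
rewrite ltr_pdivrMr// => h; have := ler_norm (s + 2 * pi * k%:R); rewrite [2 * pi * m%:R]mulrC; lra.
Qed.

Lemma le_arcdist s t : enorm (c s - c t) <= arcdist s t.
Proof.
apply: lb_le_inf; first by exists `|s - t + 2 * pi * 0%:~R|, 0.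
move=> _ [k _ <-].
have := curve_lipschitz (s + 2 * pi * k%:~R) t; rewrite curve_periodicz => /le_trans; apply.
by rewrite le_eqVlt; apply/orP; left; apply/eqP; congr `|_|; ring.
Qed.

Lemma curve_continuous_coord i : continuous (fun t => c t 0 i).
Proof.
move=> t; apply/cvgrPdist_le => e e0; apply/nbhs_ballP.
exists e => //= s; rewrite /ball/= => ts.
have h : `|c t 0 i - c s 0 i| <= enorm (c t - c s).
  rewrite -ler_sqr ?nnegrE ?enorm_ge0// sqr_enorm real_normK ?num_real// /dotv (bigD1 i)//= !mxE -expr2.
  by rewrite lerDl sumr_ge0// => j _; rewrite -expr2 sqr_ge0.
by rewrite (le_trans h)// (le_trans (curve_lipschitz _ _))// ltW.
Qed.

End Curve.

(** * Distance on the circle *)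

Section Arcdist.
Context {R : realType}.
Implicit Types s t x : R.

(** The distance from x to 2 pi Z. Slicing the energy by the shift needs [arcdist] as a function of
    the difference alone. *)
Definition circdist x : R := inf (range (fun k : int => `|x + 2 * pi * k%:~R|)).

Lemma arcdistE s t : arcdist s t = circdist (s - t). Proof. by []. Qed.

Lemma circdist_le x (k : int) : circdist x <= `|x + 2 * pi * k%:~R|.
Proof. by apply: ge_inf; [exists 0 => _ [? _ <-]|exists k]. Qed.

Lemma le_circdist x y : (forall k : int, y <= `|x + 2 * pi * k%:~R|) -> y <= circdist x.
Proof.
move=> H; apply: lb_le_inf => [|_ [k _ <-]//].
by exists `|x + 2 * pi * 0%:~R|, 0.
Qed.

Lemma circdistE t : 0 <= t <= 2 * pi -> circdist t = Num.min t (2 * pi - t).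
Proof.
move=> /andP[t0 t2]; have pi0 := @pi_gt0 R.
apply/eqP; rewrite eq_le; apply/andP; split.
  rewrite le_min; apply/andP; split.
    by have := circdist_le t 0; rewrite mulr0 addr0 ger0_norm.
  have := circdist_le t (-1); rewrite mulrN1z mulrN1 distrC ger0_norm//; lra.
apply: le_circdist => k; rewrite ge_min.
have [k0|k0] := leP 0 k.
  apply/orP; left; have : 0 <= 2 * pi * k%:~R :> R by rewrite !mulr_ge0 ?pi_ge0// ler0z.
  move=> h; rewrite ger0_norm; lra.
apply/orP; right.
have : 2 * pi * k%:~R <= 2 * pi * (-1) :> R.
  rewrite ler_pM2l ?mulr_gt0//.
  have -> : -1 = (-1)%:~R :> R by rewrite mulrN1z.
  rewrite ler_int; lia.
by move=> h; rewrite ler0_norm; lra.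
Qed.

Lemma circdistN x : circdist (- x) = circdist x.
Proof.
suff H y : circdist (- y) <= circdist y.
  by apply/eqP; rewrite eq_le H/= -{1}(opprK x) H.
apply: le_circdist => k; apply: le_trans (circdist_le _ (- k)) _.
by rewrite mulrNz mulrN -opprD normrN.
Qed.

Lemma circdistD2pi x : circdist (x + 2 * pi) = circdist x.
Proof.
apply/eqP; rewrite eq_le; apply/andP; split.
  apply: le_circdist => k; apply: le_trans (circdist_le _ (k - 1)) _.
  by rewrite rmorphB/= le_eqVlt; apply/orP; left; apply/eqP; congr `|_|; ring.
apply: le_circdist => k; apply: le_trans (circdist_le _ (k + 1)) _.
by rewrite rmorphD/= le_eqVlt; apply/orP; left; apply/eqP; congr `|_|; ring.
Qed.

Lemma continuous_circdist : continuous circdist.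
Proof.
have lip x y : circdist x <= circdist y + `|x - y|.
  rewrite -lerBlDr; apply: le_circdist => k; rewrite lerBlDr.
  apply: le_trans (circdist_le _ k) _.
  rewrite (_ : x + _ = (y + 2 * pi * k%:~R) + (x - y)); last by ring.
  exact: ler_normD.
move=> x; apply/cvgrPdist_le => e e0; apply/nbhs_ballP.
exists e => //= y; rewrite /ball/= => xy; apply: le_trans (ltW xy).
by rewrite ler_norml; have := lip x y; have := lip y x; rewrite (distrC y x); lra.
Qed.

End Arcdist.

(** * Tangent line and finiteness of the circle integral *)

Section Scalar.
Context {R : realType}.
Implicit Types x y : R.

(** Two uses of e^x >= 1 + x with v = ln w: w^p = w e^((p - 1) v) >= w + (p - 1) w v, and w v >= w -
    1. *)
Lemma bernoulli_powR (w p : R) : 0 <= w -> 1 <= p -> 1 + p * (w - 1) <= w `^ p.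
Proof.
rewrite le_eqVlt => /predU1P[<-|w0] p1.
  by rewrite powR0 ?gt_eqF//; lra.
set v := ln w.
have -> : w `^ p = w * expR ((p - 1) * v).
  by rewrite -{2}(lnK w0) -expRD /powR gt_eqF//; congr expR; rewrite -/v; ring.
have h1 : 1 + (p - 1) * v <= expR ((p - 1) * v) by exact: expR_ge1Dx.
have h2 : w * (1 - v) <= 1.
  have := expR_ge1Dx (- v); rewrite expRN lnK// => h.
  by have := h; rewrite -[X in _ <= X]mul1r ler_pdivlMr// mulrC.
have h3 : w * (1 + (p - 1) * v) <= w * expR ((p - 1) * v) by rewrite ler_pM2l.
nra.
Qed.

Lemma powRV x j : 0 <= x -> (x^-1) `^ j = (x `^ j)^-1.
Proof. by move=> x0; rewrite -powR_inv1// -powRrM mulN1r powRN. Qed.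

(* Tangent line of x |-> x^(-j/2) at r0^2, evaluated at r^2. *)
Lemma inv_powR_tangent (j r r0 : R) : 0 < j -> 0 < r -> 0 < r0 -> r != r0 ->
  (r0 `^ j)^-1 * (1 - j / 2 * (r ^+ 2 / r0 ^+ 2 - 1)) < (r `^ j)^-1.
Proof.
move=> j0 rp r0p rr0; set v := ln (r / r0).
have q0 : 0 < r / r0 by rewrite divr_gt0.
have vE : expR v = r / r0 by rewrite lnK.
have v0 : v != 0.
  apply/eqP => v0; move: vE; rewrite v0 expR0 => /esym/divr1_eq e.
  by rewrite e eqxx in rr0.
have -> : (r `^ j)^-1 = (r0 `^ j)^-1 * expR (- (j * v)).
  have -> : r = r0 * (r / r0) by rewrite mulrC divfK// gt_eqF.
  rewrite powRM ?ltW// invfM; congr (_ * _).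
  by rewrite expRN /powR gt_eqF.
rewrite ltr_pM2l ?invr_gt0 ?powR_gt0//.
(* Here (r/r0)^(-j) = e^(-j v) >= 1 - j v, and the strict inequality e^(2v) > 1 + 2v bounds v by
   (r^2/r0^2 - 1)/2. Strictness comes from the latter. *)
have h1 := expR_ge1Dx (- (j * v)).
have v20 : 2 * v != 0 by rewrite mulf_neq0// pnatr_eq0.
have h2 := expR_gt1Dx v20.
have e : expR (2 * v) = r ^+ 2 / r0 ^+ 2.
  by rewrite mulr_natl mulr2n expRD vE; field; rewrite gt_eqF.
rewrite e in h2; nra.
Qed.

(** Two tangent lines are composed: that of z^p at z0, which is Bernoulli's inequality rescaled, and
    the strict one of x^(-j/2) at x = r0^2, of slope -k. The chain rule gives h = p z0^(p - 1) k,
    which does not depend on r. *)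
Lemma energy_tangent (j p y r0 : R) : 0 < j -> 1 <= p -> 0 < r0 -> r0 < y ->
  exists2 h, 0 < h & forall r, 0 < r -> r <= y -> r != r0 ->
   ((r0 `^ j)^-1 - (y `^ j)^-1) `^ p + h * r0 ^+ 2 <
   ((r `^ j)^-1 - (y `^ j)^-1) `^ p + h * r ^+ 2.
Proof.
move=> j0 p1 r00 r0y.
have y0 : 0 < y by exact: lt_trans r0y.
pose z0 := (r0 `^ j)^-1 - (y `^ j)^-1.
have z00 : 0 < z0.
  by rewrite subr_gt0 ltf_pV2 ?posrE ?powR_gt0// gt0_ltr_powR// nnegrE ltW.
pose k := (r0 `^ j)^-1 * (j / 2) / r0 ^+ 2.
have k0 : 0 < k by rewrite !mulr_gt0// ?invr_gt0 ?powR_gt0 ?exprn_gt0// divr_gt0.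
have p0 : 0 < p by lra.
exists (p * z0 `^ (p - 1) * k); first by apply: mulr_gt0 => //; apply: mulr_gt0 => //; rewrite powR_gt0.
move=> r r_0 ry rr0.
set z := (r `^ j)^-1 - (y `^ j)^-1.
have zge0 : 0 <= z.
  by rewrite subr_ge0 lef_pV2 ?posrE ?powR_gt0// ge0_ler_powR ?nnegrE// ltW.
have zz0 : z0 - k * (r ^+ 2 - r0 ^+ 2) < z.
  have := inv_powR_tangent j0 r_0 r00 rr0; rewrite /z /z0 ltrBrDr.
  apply: le_lt_trans; rewrite le_eqVlt; apply/orP; left; apply/eqP; rewrite /k.
  by field; rewrite ?gt_eqF ?powR_gt0.
have := bernoulli_powR (divr_ge0 zge0 (ltW z00)) p1.
rewrite powRM ?invr_ge0 ?(ltW z00)// powRV ?(ltW z00)//.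
rewrite ler_pdivlMr ?powR_gt0// => h.
have z0p : z0 `^ p = z0 * z0 `^ (p - 1) by rewrite mulr_powRB1 ?ltW//; lra.
rewrite -/z0.
set c := z0 `^ (p - 1) in z0p *.
have c0 : 0 < c by rewrite powR_gt0.
have h' : z0 * c + p * c * (z - z0) <= z `^ p.
  apply: le_trans h; rewrite le_eqVlt z0p; apply/orP; left; apply/eqP.
  by field; rewrite gt_eqF.
clearbody c k z z0.
have : p * c * (z0 - k * (r ^+ 2 - r0 ^+ 2)) < p * c * z by rewrite ltr_pM2l//; exact: mulr_gt0.
rewrite z0p; lra.
Qed.

(** The left-hand side is s^(-j) (e^(j ln(s / sin s)) - 1), where ln(s / sin s) <= s^2 and e^x - 1
    <= x e^x. Since s < 2, the factor e^(j s^2) is at most e^(4j). *)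
Lemma circle_integrand_le (j s : R) : 0 < j -> 0 < s -> s <= pi / 2 ->
  (sin s `^ j)^-1 - (s `^ j)^-1 <= j * expR (4 * j) * s `^ (2 - j).
Proof.
move=> j0 s0 sp.
have s2 : s < 2 by apply: le_lt_trans sp _; have := @pihalf_lt2 R.
have pi0 := @pi_gt0 R.
have sj : s / 2 <= sin s.
  apply: le_trans (sin_ge_jordan _); last by rewrite sp ltW.
  rewrite mulrC ler_pM2r// ler_pdivlMr// mulrC ler_pdivrMr//.
  by have := @pihalf_lt2 R; lra.
have ss : 0 < sin s by apply: lt_le_trans sj; rewrite divr_gt0.
have q0 : 0 < s / sin s by rewrite divr_gt0.
have lq : ln (s / sin s) <= s ^+ 2.
  have := expR_ge1Dx (ln (s / sin s)); rewrite lnK//.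
  have : s / sin s - 1 <= s ^+ 2.
    have -> : s / sin s - 1 = (s - sin s) / sin s by field; rewrite gt_eqF.
    rewrite ler_pdivrMr//; have := sub_sin_le s0.
    have : s ^+ 2 * (s / 2) <= s ^+ 2 * sin s by rewrite ler_pM2l// exprn_gt0.
    by rewrite !exprS expr0 !mulr1; lra.
  lra.
have -> : (sin s `^ j)^-1 - (s `^ j)^-1 = (s `^ j)^-1 * ((s / sin s) `^ j - 1).
  rewrite powRM ?invr_ge0 ?(ltW ss) ?(ltW s0)// powRV ?(ltW ss)//.
  by field; rewrite !gt_eqF ?powR_gt0.
have -> : s `^ (2 - j) = (s `^ j)^-1 * s ^+ 2.
  rewrite -powRN -(powR_mulrn _ (ltW s0)) -powRD ?(gt_eqF s0) ?implybT//.
  by congr (_ `^ _); rewrite addrC.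
rewrite mulrCA ler_pM2l ?invr_gt0 ?powR_gt0//.
have -> : (s / sin s) `^ j = expR (j * ln (s / sin s)) by rewrite /powR gt_eqF.
have h1 : expR (j * ln (s / sin s)) <= expR (j * s ^+ 2) by rewrite ler_expR ler_pM2l.
have h2 : expR (j * s ^+ 2) - 1 <= j * s ^+ 2 * expR (j * s ^+ 2).
  have := expR_ge1Dx (- (j * s ^+ 2)); rewrite expRN => h.
  have e0 := expR_gt0 (j * s ^+ 2).
  have : (1 + - (j * s ^+ 2)) * expR (j * s ^+ 2) <= 1 by rewrite -ler_pdivlMr// mul1r.
  lra.
have h3 : expR (j * s ^+ 2) <= expR (4 * j) by rewrite ler_expR mulrC ler_pM2r//; nra.
have h4 : j * s ^+ 2 * expR (j * s ^+ 2) <= j * s ^+ 2 * expR (4 * j).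
  by rewrite ler_wpM2l// mulr_ge0 ?sqr_ge0// ltW.
lra.
Qed.

End Scalar.

(** * The integrand with extended real values *)

Section Kernel.
Context {R : realType}.
Implicit Types x y : R.

(* At x = 0 < y this is +oo, and at x = y = 0 it is 0 because
   (+oo - +oo) `^ p = (-oo) `^ p = 0. *)
Definition okernel (j p x y : R) : \bar R :=
  ((((x `^ j)%R%:E)^-1 - ((y `^ j)%R%:E)^-1) `^ p)%E.

Lemma okernelE (j p x y : R) : 0 < x -> 0 < y ->
  okernel j p x y = (((x `^ j)^-1 - (y `^ j)^-1) `^ p)%:E.
Proof. by move=> x0 y0; rewrite /okernel !inver !gt_eqF ?powR_gt0//. Qed.

Lemma okernel0l (j p y : R) : 0 < j -> 1 <= p -> 0 < y -> okernel j p 0 y = +oo%E.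
Proof.
move=> j0 p1 y0; rewrite /okernel powR0 ?gt_eqF// !inver eqxx gt_eqF ?powR_gt0//.
by rewrite addye// poweRyr// gt_eqF//; lra.
Qed.

Lemma okernel_ge0 (j p x y : R) : (0 <= okernel j p x y)%E.
Proof. exact: poweR_ge0. Qed.

Lemma okernel00 (j p : R) : 0 < j -> 1 <= p -> okernel j p 0 0 = 0%E.
Proof.
move=> j0 p1; rewrite /okernel powR0 ?gt_eqF// !inver eqxx /=.
by case: eqP => // p0; exfalso; lra.
Qed.

Lemma okernelZ (j p a x y : R) : 0 < j -> 1 <= p -> 0 < a -> 0 < x -> 0 < y -> x <= y ->
  okernel j p (a * x) (a * y) = ((a `^ (- (j * p)))%:E * okernel j p x y)%E.
Proof.
move=> j0 p1 a0 x0 y0 xy; rewrite !okernelE ?mulr_gt0// -EFinM; congr EFin.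
rewrite !powRM ?ltW// !invfM -mulrBr powRM ?invr_ge0 ?powR_ge0//; last first.
  by rewrite subr_ge0 lef_pV2 ?posrE ?powR_gt0// ge0_ler_powR ?nnegrE// ltW.
by congr (_ * _); rewrite powRV ?powR_ge0// -powRrM powRN.
Qed.

(** Extends the tangent inequality to r = 0, a self-intersection of the curve, where the right-hand
    side is +oo. *)
Lemma okernel_tangent (j p y r0 : R) : 0 < j -> 1 <= p -> 0 < r0 -> r0 < y ->
  exists2 h : R, 0 < h & forall r : R, 0 <= r -> r <= y -> r != r0 ->
   (okernel j p r0 y + (h * r0 ^+ 2)%:E < okernel j p r y + (h * r ^+ 2)%:E)%E.
Proof.
move=> j0 p1 r00 r0y; have y0 := lt_trans r00 r0y.
have [h h0 H] := energy_tangent j0 p1 r00 r0y.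
exists h => // r; rewrite le_eqVlt => /predU1P[<- _ _|rp ry rr0].
  by rewrite okernel0l// okernelE// addye// -EFinD ltry.
by rewrite (okernelE j p r00 y0) (okernelE j p rp y0) lte_fin; exact: H.
Qed.

Lemma measurable_okernel d (T : measurableType d) (D : set T) (j p : R) (f g : T -> R) :
  measurable_fun D f -> measurable_fun D g ->
  measurable_fun D ((fun t => okernel j p (f t) (g t)) : T -> \bar R).
Proof.
have minv (k : T -> R) : measurable_fun D k -> measurable_fun D ((fun t => ((k t `^ j)%:E)^-1)%E : T -> \bar R).
  move=> mk.
  have m1 : measurable_fun [set: R] ((fun x : R => ((x `^ j)%:E)^-1)%E : R -> \bar R).
    under eq_fun do rewrite inver -powRN.
    apply: measurable_fun_ifT => //=.
      apply: (measurable_fun_bool true) => /=.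
      have := @measurable_powR R j measurableT [set 0] (measurable_set1 0).
      by congr (measurable (_ `&` _)); apply/seteqP; split => t /= /eqP.
    by apply/measurable_EFinP; exact: measurable_powR.
  exact: (measurableT_comp m1 mk).
move=> mf mg; rewrite /okernel.
apply: (measurableT_comp (@measurable_poweR R p)).
by apply: emeasurable_funB; exact: minv.
Qed.

Lemma integral_powR_lty (a b : R) : -1 < a -> 0 < b ->
  (\int[lebesgue_measure]_(s in `]0%R, b]) (s `^ a)%:E < +oo)%E.
Proof.
move=> a1 b0; set mu := lebesgue_measure.
have a10 : 0 < a + 1 by lra.
pose F (x : R) := x `^ (a + 1) / (a + 1).
have dF (x : R) : 0 < x -> is_derive x 1 F (x `^ a).
  move=> x0; rewrite /F.
  have h := is_derive1_powR (a + 1) x0.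
  apply: is_derive_eq.
  by rewrite scaler0 add0r addrK /GRing.scale/=; field; rewrite gt_eqF.
have intF (e : R) : 0 < e -> e < b -> (\int[mu]_(s in `[e, b]) (s `^ a)%:E <= (F b)%:E)%E.
  move=> e0 eb.
  have cF (x : R) : 0 < x -> {for x, continuous F}.
    by move=> x0; apply: differentiable_continuous; apply/derivable1_diffP; case: (dF x x0).
  rewrite (@continuous_FTC2 _ _ F) //.
  - by rewrite lee_fin gerBl /F divr_ge0 ?powR_ge0// ltW.
  - apply: derivable_within_continuous => x; rewrite in_itv/= => /andP[ex _].
    by apply: derivable_powR; rewrite in_itv/= andbT; exact: lt_le_trans ex.
  - split.
    + move=> x; rewrite in_itv/= => /andP[ex _]; by case: (dF x (lt_trans e0 ex)).
    + by apply: cvg_at_right_filter; exact: cF.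
    + by apply: cvg_at_left_filter; apply: cF.
  - move=> x; rewrite in_itv/= => /andP[ex _].
    by rewrite derive1E; apply: derive_val; exact: dF (lt_trans e0 ex).
(* [n.+2] keeps the left endpoint strictly below b already at n = 0, as [intF] requires. *)
pose A (n : nat) : set R := `[b / n.+2%:R, b]%classic.
have UA : `]0%R, b]%classic = \bigcup_n A n.
  apply/seteqP; split => x /=.
    rewrite in_itv/= => /andP[x0 xb].
    exists (Num.truncn (b / x)) => //=; rewrite /A/= in_itv/= xb andbT.
    rewrite ler_pdivrMr// -ler_pdivrMl// mulrC.
    by rewrite (le_trans (ltW (truncnS_gt _)))// ler_nat.
  move=> [n _]; rewrite /A/= !in_itv/= => /andP[h ->]; rewrite andbT.
  by apply: lt_le_trans h; rewrite divr_gt0.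
have mf D : measurable_fun D ((fun s => (s `^ a)%:E) : R -> \bar R).
  by apply/measurable_EFinP; apply: measurable_funTS; exact: measurable_powR.
apply: (@le_lt_trans _ _ (F b)%:E); last exact: ltry.
rewrite UA.
have ndA : nondecreasing_seq A.
  apply/nondecreasing_seqP => n; rewrite subsetEset => x /=.
  rewrite /A/= !in_itv/= => /andP[h ->]; rewrite andbT; apply: le_trans h.
  by rewrite ler_pM2l// lef_pV2 ?posrE// ler_nat.
have mA i : measurable (A i) by exact: measurable_itv.
have f0 i x : A i x -> (0 <= (x `^ a)%:E)%E by rewrite lee_fin powR_ge0.
pose mu' : measure (measurableTypeR R) R := @lebesgue_measure R.
have nd := @ge0_nondecreasing_set_nondecreasing_integral _ (measurableTypeR R) R A
  (fun s : R => (s `^ a)%:E) mu' ndA mA (fun i => mf _) f0.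
have := @ge0_nondecreasing_set_cvg_integral _ (measurableTypeR R) R A
  (fun s : R => (s `^ a)%:E) mu' ndA mA (fun i => mf _) f0.
move=> /cvg_lim <- //.
apply: lime_le; first exact: ereal_nondecreasing_is_cvgn.
apply: nearW => n; apply: intF; first by rewrite divr_gt0.
by rewrite ltr_pdivrMr// ltr_pMr// ltr1n.
Qed.

(** The condition j < 2 + 1/p says exactly that (2 - j) p > -1, so the p-th power of the bound in
    [circle_integrand_le] is integrable at 0. *)
Lemma circle_integral_lty (j p : R) : 0 < j -> 1 <= p -> j < 2 + 1 / p ->
  (\int[lebesgue_measure]_(s in `[0%R, (pi / 2)%R]) okernel j p (sin s) s < +oo)%E.
Proof.
move=> j0 p1 jp.
have p0 : 0 < p by lra.
have pi0 : 0 < pi / 2 :> R by rewrite divr_gt0 ?pi_gt0.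
have a1 : -1 < (2 - j) * p.
  have : (j - 2) * p < 1 by rewrite -ltr_pdivlMr//; lra.
  lra.
have msin D : measurable_fun D (fun s : R => sin s).
  by apply: measurable_funTS; apply: continuous_measurable_fun; exact: continuous_sin.
have mok : measurable_fun `[0, (pi / 2)] (fun s : R => okernel j p (sin s) s).
  exact: measurable_okernel.
rewrite -(@integral_itv_obnd_cbnd R 0 (BRight (pi / 2))); last first.
  by apply: measurable_funS mok => //; exact: subset_itv_oc_cc.
pose C := (j * expR (4 * j)) `^ p.
have mpow D : measurable_fun D ((fun s => (s `^ ((2 - j) * p))%:E) : R -> \bar R).
  by apply/measurable_EFinP; apply: measurable_funTS; exact: measurable_powR.
apply: (@le_lt_trans _ _ (\int[lebesgue_measure]_(s in `]0%R, (pi / 2)%R]) (C%:E * (s `^ ((2 - j) * p))%:E))%E).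
  apply: ge0_le_integral => //=.
  - by move=> s _; exact: okernel_ge0.
  - by apply: measurable_funS mok => //; exact: subset_itv_oc_cc.
  - suff : measurable_fun `]0, pi / 2] ((fun s => (C * s `^ ((2 - j) * p))%:E) : R -> \bar R) by [].
    apply/measurable_EFinP; apply: measurable_funM => //.
    by apply: measurable_funTS; exact: measurable_powR.
  - move=> s; rewrite in_itv/= => /andP[s0 sp].
    have ss : 0 < sin s.
      by apply: sin_gt0_pi; rewrite s0/=; apply: le_lt_trans sp _; lra.
    rewrite okernelE// -EFinM lee_fin /C powRrM -powRM ?powR_ge0//; last first.
      by rewrite mulr_ge0 ?expR_ge0// ltW.
    rewrite ge0_ler_powR ?nnegrE ?(ltW p0)//; last first.
    - exact: circle_integrand_le.
    - by rewrite !mulr_ge0 ?powR_ge0 ?expR_ge0// ltW.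
    - rewrite subr_ge0 lef_pV2 ?posrE ?powR_gt0// ge0_ler_powR ?nnegrE ?(ltW ss) ?(ltW s0) ?(ltW j0)//.
      exact: ltW (sin_lt s0).
rewrite ge0_integralZl//; last 3 first.
- exact: mpow.
- by move=> s _; rewrite lee_fin powR_ge0.
- by rewrite lee_fin powR_ge0.
have := integral_powR_lty a1 pi0.
by apply: lte_mul_pinfty => //; rewrite lee_fin powR_ge0.
Qed.

End Kernel.

(** * Integration *)

Section ChangeOfVariables.
Context {R : realType}.
Local Notation mu := (@lebesgue_measure R).

Lemma measurable_affine (a b : R) :
  measurable_fun setT (fun x : measurableTypeR R => a * x + b : measurableTypeR R).
Proof.
apply: continuous_measurable_fun => x.
by apply: cvgD; [apply: cvgMr; exact: cvg_id|exact: cvg_cst].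
Qed.

(** By uniqueness of Lebesgue measure it suffices to test intervals ]c, d]. Negative a, needed for
    the reflection t -> 2 pi - t, swaps the closed and open ends but keeps the length. *)
Lemma lebesgue_measure_affine (a b : R) (A : set (measurableTypeR R)) :
  a != 0 -> measurable A ->
  (`|a|%:E * mu ((fun x : R => (a * x + b)%R) @^-1` A) = mu A)%E.
Proof.
move=> a0 mA.
pose phi := fun x : measurableTypeR R => a * x + b : measurableTypeR R.
pose nu : {measure set (measurableTypeR R) -> \bar R} :=
  mscale (NngNum (normr_ge0 a)) (pushforward mu phi).
suff : mu A = nu (measurable_affine a b) A by rewrite /nu /= /mscale /= => ->.
apply: lebesgue_measure_unique => // _ [[c d]] /= cd <-.
rewrite /nu /= /mscale /= /pushforward /=.
move: a0; rewrite neq_lt => /orP[a0|a0].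
- have -> : (fun x => a * x + b) @^-1` `]c, d] = `[(d - b) / a, (c - b) / a[%classic.
    apply/seteqP; split => x /=; rewrite !in_itv/= ltr_ndivlMr// ler_ndivrMr// ltrBlDr lerBrDr mulrC andbC//.
  rewrite !lebesgue_measure_itv/= !lte_fin ltr_nM2r ?invr_lt0// ltrD2r.
  case: ifP => _; last by rewrite mule0.
  rewrite -!EFinD -EFinM ltr0_norm//; congr EFin; field; rewrite ?lt_eqF//.
- have -> : (fun x => a * x + b) @^-1` `]c, d] = `](c - b) / a, (d - b) / a]%classic.
    apply/seteqP; split => x /=; rewrite !in_itv/= ltr_pdivrMr// ler_pdivlMr// ltrBlDr lerBrDr mulrC//.
  rewrite !lebesgue_measure_itv/= !lte_fin ltr_pM2r ?invr_gt0// ltrD2r.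
  case: ifP => _; last by rewrite mule0.
  rewrite -!EFinD -EFinM gtr0_norm//; congr EFin; field; rewrite ?gt_eqF//.
Qed.

Lemma ge0_integral_affine (a b : R) (D : set R) (f : R -> \bar R) : a != 0 ->
  measurable D -> measurable_fun D f -> (forall x, D x -> 0 <= f x)%E ->
  (\int[mu]_(x in D) f x =
   `|a|%:E * \int[mu]_(x in (fun x => (a * x + b)%R) @^-1` D) f (a * x + b)%R)%E.
Proof.
move=> a0 mD mf f0.
rewrite -[X in (_ * X)%E](@ge0_integral_pushforward _ _ _ _ R _ (measurable_affine a b) mu D f) //; last first.
  by move=> y; rewrite inE => /f0.
rewrite -(ge0_integral_mscale _ _ (NngNum (normr_ge0 a))) //.
  exact: measurable_affine.
move=> mphi; apply: eq_measure_integral => //= A mA AD.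
by rewrite /mscale/= /pushforward lebesgue_measure_affine.
Qed.

Lemma ge0_integral_translation (b : R) (D : set R) (f : R -> \bar R) :
  measurable D -> measurable_fun D f -> (forall x, D x -> 0 <= f x)%E ->
  (\int[mu]_(x in D) f x = \int[mu]_(x in (fun x => (x + b)%R) @^-1` D) f (x + b)%R)%E.
Proof.
move=> mD mf f0; rewrite (@ge0_integral_affine 1 b)// ?oner_neq0// normr1 mul1e.
have -> : (fun x : R => 1 * x + b) = (fun x => x + b) by apply/funext => x; rewrite mul1r.
by apply: eq_integral => x _; rewrite mul1r.
Qed.

Lemma ge0_integral_itv_split (a b c : R) (f : R -> \bar R) : a <= b -> b <= c ->
  measurable_fun `[a, c] f -> (forall x, 0 <= f x)%E ->
  (\int[mu]_(x in `[a, c]) f x = \int[mu]_(x in `[a, b]) f x + \int[mu]_(x in `[b, c]) f x)%E.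
Proof.
move=> ab bc mf f0.
rewrite -[X in (_ + X)%E](@integral_itv_obnd_cbnd R b (BRight c)); last first.
  apply: measurable_funS mf => // x /=; rewrite !in_itv/= => /andP[bx ->]; rewrite andbT.
  by rewrite (le_trans ab)// ltW.
have e : `[a, c]%classic = `[a, b]%classic `|` `]b, c]%classic.
  apply/seteqP; split => x /=; rewrite !in_itv/=.
    move=> /andP[ax xc]; have [xb|bx] := leP x b; [left|right]; by rewrite ?ax ?xc ?xb ?bx.
  move=> [/andP[-> xb]|/andP[bx ->]]; rewrite ?andbT/=; first exact: le_trans bc.
  by rewrite (le_trans ab)// ltW.
rewrite e ge0_integral_setU// -?e//.
apply/disj_setPRL => x /=; rewrite !in_itv/= => /andP[bx _] /andP[_ xb].
by move: bx; rewrite ltNge xb.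
Qed.

(** The window [s, T + s] is cut at T, and the overhang [T, T + s] is moved back by one period. *)
Lemma ge0_integral_periodic (T s : R) (f : R -> \bar R) : 0 <= s <= T ->
  measurable_fun setT f -> (forall x, 0 <= f x)%E -> (forall x, f (x + T)%R = f x) ->
  (\int[mu]_(x in `[0%R, T]) f (x + s)%R = \int[mu]_(x in `[0%R, T]) f x)%E.
Proof.
move=> /andP[s0 sT] mf f0 fT.
have mfD (D : set R) : measurable_fun D f by apply: measurable_funTS.
have e1 : (\int[mu]_(x in `[0%R, T]) f (x + s)%R = \int[mu]_(x in `[s, (T + s)%R]) f x)%E.
  rewrite [RHS](ge0_integral_translation s)//.
  have -> : (fun x => x + s) @^-1` `[s, T + s] = `[0, T]%classic.
    by apply/seteqP; split => x /=; rewrite !in_itv/= lerD2r lerDr.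
  by [].
have e2 : (\int[mu]_(x in `[T, (T + s)%R]) f x = \int[mu]_(x in `[0%R, s]) f x)%E.
  rewrite (ge0_integral_translation T)//.
  have -> : (fun x => x + T) @^-1` `[T, T + s] = `[0, s]%classic.
    by apply/seteqP; split => x /=; rewrite !in_itv/= lerDr (addrC T) lerD2r.
  by apply: eq_integral => x _; rewrite fT.
rewrite e1 (@ge0_integral_itv_split s T (T + s))//; last by rewrite lerDl.
by rewrite e2 addeC -ge0_integral_itv_split.
Qed.

End ChangeOfVariables.

(** * Tonelli's theorem on rectangles *)

Section Tonelli.
Context d1 d2 (T1 : measurableType d1) (T2 : measurableType d2) (R : realType).
Variable m1 : {sigma_finite_measure set T1 -> \bar R}.
Variable m2 : {sigma_finite_measure set T2 -> \bar R}.
Variables (A : set T1) (B : set T2) (F : T1 * T2 -> \bar R).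
Hypotheses (mA : measurable A) (mB : measurable B).
Hypotheses (mF : measurable_fun setT F) (F0 : forall z, (0 <= F z)%E).

Let mAB : measurable (A `*` B). Proof. exact: measurableX. Qed.
Let mFAB : measurable_fun setT (F \_ (A `*` B)).
Proof.
apply/(measurable_restrictT F mAB).
exact: (measurable_funTS mF).
Qed.
Let FAB0 z : (0 <= (F \_ (A `*` B)) z)%E.
Proof. exact: erestrict_ge0. Qed.

Lemma integral_rectangle1 :
  (\int[m1 \x m2]_(z in A `*` B) F z = \int[m1]_(x in A) \int[m2]_(y in B) F (x, y))%E.
Proof.
rewrite integral_mkcond (fubini_tonelli1 (F \_ (A `*` B)) mFAB FAB0).
rewrite [RHS]integral_mkcond; apply: eq_integral => x _.
rewrite /fubini_F [RHS]patchE; case: ifPn => xA.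
  rewrite [RHS]integral_mkcond; apply: eq_integral => y _; rewrite !patchE.
  by rewrite in_setX xA.
by apply: integral0_eq => y _; rewrite patchE in_setX/= (negbTE xA).
Qed.

Lemma integral_rectangle2 :
  (\int[m1 \x m2]_(z in A `*` B) F z = \int[m2]_(y in B) \int[m1]_(x in A) F (x, y))%E.
Proof.
rewrite integral_mkcond (fubini_tonelli2 (F \_ (A `*` B)) mFAB FAB0).
rewrite [RHS]integral_mkcond; apply: eq_integral => y _.
rewrite /fubini_G [RHS]patchE; case: ifPn => yB.
  rewrite [RHS]integral_mkcond; apply: eq_integral => x _; rewrite !patchE.
  by rewrite in_setX yB andbT.
by apply: integral0_eq => x _; rewrite patchE in_setX/= (negbTE yB) andbF.
Qed.

Lemma measurable_section_integral :
  measurable_fun B (fun y => \int[m1]_(x in A) F (x, y))%E.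
Proof.
have := measurable_fun_fubini_tonelli_G (m1 := m1) _ mFAB FAB0.
move=> /(@measurable_funTS _ _ _ _ B); apply: eq_measurable_fun => y yB.
rewrite /fubini_G [RHS]integral_mkcond; apply: eq_integral => x _.
by rewrite !patchE in_setX yB andbT.
Qed.

End Tonelli.

(** * The mean squared chord *)

Section MeanChord.
Context {R : realType} {n : nat}.
Local Notation mu := (@lebesgue_measure R).
Variable c : R -> 'rV[R]_n.
Hypothesis hc : closed_unit_speed_curve c.

Lemma measurable_chord d (T : measurableType d) (D : set T) (f g : T -> R) :
  measurable_fun D f -> measurable_fun D g ->
  measurable_fun D (fun t => enorm (c (f t) - c (g t))).
Proof.
move=> mf mg; rewrite /enorm.
apply: (measurableT_comp (f := @Num.sqrt R)).
  by apply: continuous_measurable_fun; exact: sqrt_continuous.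
rewrite /dotv; apply: measurable_sum => i.
have mc : measurable_fun [set: R] (fun t => c t 0 i).
  by apply: continuous_measurable_fun; exact: curve_continuous_coord.
have mi : measurable_fun D (fun t => (c (f t) - c (g t)) 0 i).
  rewrite (_ : (fun t => _) = (fun t => c (f t) 0 i - c (g t) 0 i)).
    by apply: measurable_funB; [exact: (measurableT_comp mc mf)|exact: (measurableT_comp mc mg)].
  by apply/funext => t; rewrite !mxE.
exact: measurable_funM.
Qed.

Lemma discrete_wirtinger_rV (N m : nat) (x : nat -> 'rV[R]_n) : (0 < N)%N -> (m <= N)%N ->
  (forall k, x (k + N)%N = x k) ->
  sin (pi / N%:R) ^+ 2 * \sum_(k < N) enorm (x (k + m)%N - x k) ^+ 2 <=
  sin (m%:R * (pi / N%:R)) ^+ 2 * \sum_(k < N) enorm (x k.+1 - x k) ^+ 2.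
Proof.
move=> N0 mN xN.
have sqE (y z : nat -> 'rV[R]_n) : \sum_(k < N) enorm (y k - z k) ^+ 2 =
    \sum_(i < n) \sum_(k < N) (y k 0 i - z k 0 i) ^+ 2.
  rewrite exchange_big; apply: eq_bigr => k _; rewrite sqr_enorm.
  by apply: eq_bigr => i _; rewrite !mxE expr2.
rewrite (sqE (fun k => x (k + m)%N)) (sqE (fun k => x k.+1)) !mulr_sumr.
apply: ler_sum => i _; apply: (discrete_wirtinger N0 mN (x := fun k => x k 0 i)) => k.
by rewrite xN.
Qed.

(** Not normalized: this is 2 pi times the mean. *)
Definition sqchord_mean (t : R) : \bar R :=
  (\int[mu]_(s in `[0%R, (2 * pi)%R]) (enorm (c (s + t) - c s) ^+ 2)%:E)%E.

Let pi0 : 0 < pi :> R. Proof. exact: pi_gt0. Qed.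
Let twopi0 : 0 <= 2 * pi :> R. Proof. by rewrite mulr_ge0// ltW. Qed.

Lemma measurable_sqchord (D : set R) (a b : R) :
  measurable_fun D (fun s => (enorm (c (s + a) - c (s + b)) ^+ 2)%:E).
Proof.
apply/measurable_EFinP; apply: measurable_funX; apply: measurable_chord;
by apply: measurable_funD => //; exact: measurable_cst.
Qed.

Lemma measurable_sqchord0 (D : set R) (a : R) :
  measurable_fun D (fun s => (enorm (c (s + a) - c s) ^+ 2)%:E).
Proof.
by have := @measurable_sqchord D a 0; under eq_fun do rewrite addr0.
Qed.

Lemma integral_cst_period (r : \bar R) :
  (\int[mu]_(s in `[0%R, (2 * pi)%R]) r = r * (2 * pi)%R%:E)%E.
Proof.
rewrite integral_cst//= lebesgue_measure_itv/= lte_fin mulr_gt0//.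
by rewrite -EFinD subr0.
Qed.

(* The inscribed N-gons with vertices c(s + 2k pi/N) have sides of length at most
   2 pi/N; averaging the discrete inequality over the base point s turns each
   sum of squared chords into N times the mean. *)
Lemma sqchord_mean_discrete (N m : nat) : (1 < N)%N -> (m <= N)%N ->
  (sqchord_mean (m%:R * (2 * (pi / N%:R))) <=
   (2 * pi * (4 * sin (m%:R * (pi / N%:R)) ^+ 2 * ((pi / N%:R) / sin (pi / N%:R)) ^+ 2))%:E)%E.
Proof.
move=> N1 mN; have N0 : (0 < N)%N by lia.
have NR : 0 < N%:R :> R by rewrite ltr0n.
set w := pi / N%:R.
have w0 : 0 < w by rewrite divr_gt0.
have Nw : N%:R * w = pi by rewrite /w mulrC divfK// gt_eqF.
have wpi : w < pi by rewrite -Nw ltr_pMl// ltr1n.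
have sw : 0 < sin w by apply: sin_gt0_pi; rewrite w0.
have w20 : 0 <= 2 * w by rewrite mulr_ge0// ltW.
pose F (m k : nat) (s : R) := enorm (c (s + (k + m)%:R * (2 * w)) - c (s + k%:R * (2 * w))) ^+ 2.
have mF m' k D : measurable_fun D (fun s => (F m' k s)%:E) by exact: measurable_sqchord.
have F0 m' k s : (0 <= (F m' k s)%:E)%E by rewrite lee_fin sqr_ge0.
have pt s : sin w ^+ 2 * \sum_(k < N) F m k s <= sin (m%:R * w) ^+ 2 * (N%:R * (2 * w) ^+ 2).
  pose x (k : nat) := c (s + k%:R * (2 * w)).
  have xN k : x (k + N)%N = x k.
    rewrite /x -[RHS](curve_periodicz hc 1) mulr1z mulr1; congr c.
    by rewrite natrD -Nw; ring.
  apply: le_trans (discrete_wirtinger_rV N0 mN xN) _.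
  rewrite ler_wpM2l ?sqr_ge0// [leRHS]mulr_natl -[N in leRHS]card_ord -sumr_const.
  apply: ler_sum => k _; rewrite ler_sqr ?nnegrE ?enorm_ge0//.
  apply: le_trans (curve_lipschitz hc _ _) _.
  rewrite (_ : _ - _ = 2 * w); last by rewrite -natr1; ring.
  by rewrite ger0_norm.
have kper (k : 'I_N) : (\int[mu]_(s in `[0%R, (2 * pi)%R]) (F m k s)%:E = sqchord_mean (m%:R * (2 * w)))%E.
  have kN : 0 <= k%:R * (2 * w) <= 2 * pi.
    by rewrite mulr_ge0//= mulrCA ler_pM2l// -Nw ler_pM2r// ler_nat ltnW.
  have cp z : c (z + 2 * pi) = c z by have := curve_periodicz hc 1 z; rewrite mulr1z mulr1.
  rewrite /sqchord_mean.
  have := @ge0_integral_periodic R (2 * pi) (k%:R * (2 * w))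
    (fun s => (enorm (c (s + m%:R * (2 * w)) - c s) ^+ 2)%:E) kN (@measurable_sqchord0 _ _).
  move=> <-.
  - apply: eq_integral => s _; rewrite /F; congr ((enorm (c _ - _) ^+ 2)%:E).
    by rewrite natrD; ring.
  - by move=> s; rewrite lee_fin sqr_ge0.
  - by move=> s; rewrite cp addrAC cp.
have mS : measurable_fun `[0, (2 * pi)] (fun s : R => \sum_(k < N) (F m k s)%:E)%E.
  by apply: emeasurable_sum => k; exact: mF.
have mS2 : measurable_fun `[0, (2 * pi)]
    (fun s : R => (sin w ^+ 2)%:E * \sum_(k < N) (F m k s)%:E)%E.
  exact: measurable_funeM.
have : (\int[mu]_(s in `[0%R, (2 * pi)%R]) ((sin w ^+ 2)%:E * \sum_(k < N) (F m k s)%:E) <=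
   (sin (m%:R * w) ^+ 2 * (N%:R * (2 * w) ^+ 2) * (2 * pi))%:E)%E.
  rewrite [X in (_ <= X)%E]EFinM -integral_cst_period; apply: ge0_le_integral => //.
  - move=> s _; rewrite mule_ge0// ?lee_fin ?sqr_ge0//; exact: sume_ge0.
  - by move=> s _; rewrite sumEFin -EFinM lee_fin; exact: pt.
rewrite ge0_integralZl//; last 2 first.
- by move=> s _; exact: sume_ge0.
- by rewrite lee_fin sqr_ge0.
rewrite ge0_integral_sum//; last by move=> k; exact: mF.
under eq_bigr do rewrite kper.
set G := sqchord_mean _.
have G0 : (0 <= G)%E by apply: integral_ge0 => s _; rewrite lee_fin sqr_ge0.
(* An infinite [G] would make the left-hand side +oo against a finite bound. *)
case: G G0 => [g|_|//]; last first.
  rewrite -(prednK N0) big_ord_recl addye ?gt0_muley ?lte_fin ?exprn_gt0//.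
  by rewrite gt_eqF// (lt_le_trans ltNy0)// sume_ge0.
move=> _; rewrite sumEFin sumr_const card_ord -EFinM !lee_fin => H.
have sw2 : 0 < sin w ^+ 2 by rewrite exprn_gt0.
rewrite -(ler_pM2l sw2) -(ler_pM2l NR).
have -> : N%:R * (sin w ^+ 2 * (2 * pi * (4 * sin (m%:R * w) ^+ 2 * (w / sin w) ^+ 2))) =
  sin (m%:R * w) ^+ 2 * (N%:R * (2 * w) ^+ 2) * (2 * pi).
  by field; rewrite gt_eqF.
apply: le_trans H; rewrite -mulr_natl le_eqVlt; apply/orP; left; apply/eqP; ring.
Qed.

(** The shift t is rounded down to a grid value T = 2 m w with w = pi/N, where the discrete bound
    applies. Every error is O(w), and N is arbitrarily large. *)
Lemma sqchord_mean_le (t : R) : 0 <= t <= 2 * pi ->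
  (sqchord_mean t <= (2 * pi * (2 * sin (t / 2)) ^+ 2)%:E)%E.
Proof.
move=> /andP[t0 t2].
set S := sin (t / 2) ^+ 2.
have S1 : S <= 1 by rewrite /S sin2cos2 gerBl sqr_ge0.
have S0 : 0 <= S by rewrite sqr_ge0.
(* N > 3 ensures w <= 1. The errors add up to 4w + 12w + 12w from the product 4 (S + w) (1 + 3w),
   using S <= 1, plus 36w from moving t to T; 80w covers them. *)
have key (N : nat) : (3 < N)%N ->
  (sqchord_mean t <= (2 * pi * (4 * S + 80 * (pi / N%:R)))%:E)%E.
  move=> N3.
  have NR : 0 < N%:R :> R by rewrite ltr0n; lia.
  set w := pi / N%:R.
  have w0 : 0 < w by rewrite divr_gt0.
  have Nw : N%:R * w = pi by rewrite /w mulrC divfK// gt_eqF.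
  have wpi : 4 * w <= pi by rewrite -Nw ler_pM2r// (ler_nat R 4 N).
  have pi4 : pi < 4 :> R by have := @pihalf_lt2 R; lra.
  have w1 : w <= 1 by lra.
  pose m := Num.truncn (t / (2 * w)).
  have q0 : 0 <= t / (2 * w) by rewrite divr_ge0// mulr_ge0// ltW.
  have mt : m%:R * (2 * w) <= t.
    by rewrite -ler_pdivlMr ?mulr_gt0 ?invr_gt0// truncn_le.
  have tm : t <= m%:R * (2 * w) + 2 * w.
    have : t / (2 * w) < m.+1%:R by exact: truncnS_gt.
    by rewrite ltr_pdivrMr ?mulr_gt0 ?invr_gt0// -[in m.+1%:R]natr1 mulrDl mul1r => /ltW.
  have mN : (m <= N)%N.
    rewrite -(ler_nat R) -(ler_pM2r w0) Nw; lra.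
  have N1 : (1 < N)%N by exact: leq_trans N3.
  have := sqchord_mean_discrete N1 mN; rewrite -/w.
  set T := m%:R * (2 * w) in mt tm * => Hd.
  have sw : 0 < sin w by apply: sin_gt0_pi; rewrite w0/=; lra.
  have wsw : w / sin w <= 1 + w ^+ 2.
    have sj : w / 2 <= sin w.
      apply: le_trans (sin_ge_jordan _); last by apply/andP; split; lra.
      rewrite mulrC ler_pM2r// ler_pdivlMr//; lra.
    rewrite ler_pdivrMr//; have := sub_sin_le w0.
    have : w ^+ 2 * (w / 2) <= w ^+ 2 * sin w by rewrite ler_pM2l// exprn_gt0.
    by rewrite !exprS expr0 !mulr1; lra.
  have wsw2 : (w / sin w) ^+ 2 <= 1 + 3 * w.
    have : (w / sin w) ^+ 2 <= (1 + w ^+ 2) ^+ 2.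
      rewrite ler_sqr// ?nnegrE; first by rewrite divr_ge0// ltW.
      by rewrite addr_ge0// sqr_ge0.
    have : w ^+ 2 <= w by rewrite expr2 ler_piMr// ltW.
    have := sqr_ge0 w; nra.
  have sS : sin (m%:R * w) ^+ 2 <= S + w.
    have d0 : 0 <= t / 2 - m%:R * w by rewrite /T in mt; lra.
    have d1 : t / 2 - m%:R * w <= w by rewrite /T in tm; lra.
    have sd : sin (t / 2 - m%:R * w) <= w.
      move: d0; rewrite le_eqVlt => /predU1P[<-|d0]; first by rewrite sin0 ltW.
      exact: le_trans (ltW (sin_lt d0)) d1.
    have sd0 : 0 <= sin (t / 2 - m%:R * w) by apply: sin_ge0_pi; rewrite d0/=; lra.
    rewrite (sin_sqr_sub (t / 2)) -/S; have := sin_geN1 (t / 2 + m%:R * w); nra.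
  (* With v the chord at T, v <= 2 pi < 8, and the chord at t is at most v + 2w. Hence the squares
     differ by at most 4 v w + 4 w^2 <= 36 w. *)
  have le1 : (sqchord_mean t <= sqchord_mean T + (2 * pi * (36 * w))%:E)%E.
    rewrite [X in (_ <= _ + X)%E](_ : _ = (\int[mu]_(s in `[0%R, (2 * pi)%R]) (36 * w)%:E)%E); last first.
      by rewrite integral_cst_period -EFinM mulrC.
    rewrite /sqchord_mean -ge0_integralD//; last 3 first.
    - by move=> s _; rewrite lee_fin sqr_ge0.
    - exact: measurable_sqchord0.
    - by move=> s _; rewrite lee_fin; lra.
    have pt (s : R) : enorm (c (s + t) - c s) ^+ 2 <= enorm (c (s + T) - c s) ^+ 2 + 36 * w.
      have h1 : enorm (c (s + t) - c s) <= enorm (c (s + T) - c s) + 2 * w.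
        apply: le_trans (enorm_triangleB _ (c (s + T)) _) _.
        rewrite addrC lerD2l; apply: le_trans (curve_lipschitz hc _ _) _.
        by rewrite ger0_norm; lra.
      have h2 : enorm (c (s + T) - c s) <= 2 * pi.
        apply: le_trans (curve_lipschitz hc _ _) _.
        have T0 : 0 <= T by rewrite !mulr_ge0// ltW.
        by rewrite ger0_norm; lra.
      have h3 := enorm_ge0 (c (s + T) - c s).
      have h4 := enorm_ge0 (c (s + t) - c s).
      set u := enorm (c (s + t) - c s) in h1 h4 *.
      set v := enorm (c (s + T) - c s) in h1 h2 h3 *.
      have : u ^+ 2 <= (v + 2 * w) ^+ 2 by rewrite ler_sqr ?nnegrE// (le_trans h4).
      nra.
    apply: ge0_le_integral => //.
    - by move=> s _; rewrite lee_fin sqr_ge0.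
    - exact: measurable_sqchord0.
    - by apply: emeasurable_funD => //; exact: measurable_sqchord0.
    - by move=> s _; rewrite -EFinD lee_fin.
  apply: le_trans le1 _.
  apply: (@le_trans _ _ ((2 * pi * (4 * (S + w) * (1 + 3 * w)))%:E + (2 * pi * (36 * w))%:E)%E).
    rewrite leeD2r//; apply: le_trans Hd _; rewrite lee_fin ler_pM2l ?mulr_gt0//.
    apply: ler_pM => //; [by rewrite mulr_ge0 ?sqr_ge0|exact: sqr_ge0|by rewrite ler_pM2l].
  rewrite -EFinD lee_fin -mulrDr ler_pM2l ?mulr_gt0//; nra.
have -> : (2 * sin (t / 2)) ^+ 2 = 4 * S by rewrite exprMn /S -natrX.
apply/lee_addgt0Pr => e e0.
pose N := (Num.truncn (2 * pi * (80 * pi) / e)).+4.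
have : (3 < N)%N by [].
move/key => /le_trans; apply; rewrite -EFinD lee_fin mulrDr lerD2l.
have NR : 0 < N%:R :> R by rewrite ltr0n.
rewrite !mulrA ler_pdivrMr// mulrC -ler_pdivrMl// mulrC.
have : 2 * pi * (80 * pi) / e < N%:R.
  apply: lt_le_trans (truncnS_gt _) _; rewrite ler_nat /N.
  by rewrite -[X in (X <= _)%N]addn1 -[X in (_ <= X)%N]addn4 leq_add2l.
by rewrite [e^-1 * _]mulrC !mulrA => /ltW.
Qed.

End MeanChord.

(** * The energy and its equality case *)

(** The finite integral of f can be cancelled, so g - f >= 0 has integral 0. *)
Lemma ae_eq_of_integral_le d (T : measurableType d) (R : realType)
    (mu : {measure set T -> \bar R}) (D : set T) (f g : T -> \bar R) :
  measurable D -> measurable_fun D f -> measurable_fun D g ->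
  (forall x, D x -> 0 <= f x)%E -> (forall x, D x -> f x \is a fin_num) ->
  (forall x, D x -> f x <= g x)%E ->
  (\int[mu]_(x in D) f x < +oo)%E ->
  (\int[mu]_(x in D) g x <= \int[mu]_(x in D) f x)%E ->
  ae_eq mu D f g.
Proof.
move=> mD mf mg f0 ffin fg foo gf.
have mgf : measurable_fun D (fun x => g x - f x)%E by exact: emeasurable_funB.
have gf0 x : D x -> (0 <= g x - f x)%E by move=> Dx; rewrite sube_ge0 ?fg ?ffin.
have If : (\int[mu]_(x in D) f x)%E \is a fin_num.
  by rewrite ge0_fin_numE//; exact: integral_ge0.
have e : (\int[mu]_(x in D) g x = \int[mu]_(x in D) f x + \int[mu]_(x in D) (g x - f x))%E.
  rewrite -ge0_integralD//; apply: eq_integral => x /[!inE] Dx.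
  by rewrite addeC subeK// ffin.
have z : (\int[mu]_(x in D) `|g x - f x| = 0)%E.
  rewrite (eq_integral (fun x => g x - f x)%E); last by move=> x /[!inE] Dx; rewrite gee0_abs// gf0.
  apply/eqP; rewrite eq_le integral_ge0// andbT.
  by move: gf; rewrite e -[X in (_ <= X)%E]adde0 leeD2lE.
have := (ae_eq_integral_abs mu mD mgf).1 z.
apply: filterS => x /= H Dx.
by rewrite -[RHS](@subeK _ _ (f x)) ?ffin// H// add0e.
Qed.

Lemma ae_mono (R : realType) (P Q : R -> Prop) :
  {ae lebesgue_measure, forall x : R, P x} -> (forall x, P x -> Q x) ->
  {ae lebesgue_measure, forall x : R, Q x}.
Proof.
move=> [N [mN N0 PN]] PQ; exists N; split => // x nQ.
by apply: PN => /PQ.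
Qed.

(** The factor 2 is there because each application collects two errors of size e. *)
Lemma eq_of_dist_le (R : realType) (x y : R) :
  (forall e, 0 < e -> `|x - y| <= 2 * e) -> x = y.
Proof.
move=> H; apply/eqP; rewrite -subr_eq0 -normr_le0; apply/ler_addgt0Pl => e e0.
rewrite addr0; have := H (e / 2) (divr_gt0 e0 (ltr0n _ 2)).
by rewrite [2 * _]mulrC divfK// pnatr_eq0.
Qed.

(** Otherwise the nonempty interval ]l, r[ of points of ]a, b[ within e of x would be negligible.
    Allowing x to be an endpoint covers the closed period. *)
Lemma ae_dense_itv (R : realType) (a b x e : R) (P : R -> Prop) : a < b -> a <= x <= b -> 0 < e ->
  {ae lebesgue_measure, forall y : R, `]a, b[%classic y -> P y} ->
  exists2 y, `]a, b[%classic y & `|y - x| < e /\ P y.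
Proof.
move=> ab /andP[ax xb] e0 [N [mN N0 HN]].
pose l := Num.max a (x - e); pose r := Num.min b (x + e).
have lr : l < r by rewrite /l /r lt_min !gt_max ab; apply/andP; split; apply/andP; split; lra.
apply: contrapT => nex.
have sub : `]l, r[%classic `<=` N.
  move=> y /=; rewrite in_itv/= lt_min gt_max => /andP[/andP[ay xey] /andP[yb yxe]].
  apply: HN => /= H; apply: nex; exists y; first by rewrite /= in_itv/= ay yb.
  by split; [rewrite ltr_norml; lra|apply: H; rewrite /= in_itv/= ay yb].
have : (lebesgue_measure `]l, r[%classic <= lebesgue_measure N)%E.
  by apply: le_measure => //; rewrite inE.
rewrite N0 lebesgue_measure_itv/= lte_fin lr -EFinD lee_fin; lra.
Qed.

(** * Slices of the energy at a fixed shift *)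

Section Energy.
Context {R : realType} {n : nat}.
Local Notation mu := (@lebesgue_measure R).
Variables (j p : R) (c : R -> 'rV[R]_n).
Hypotheses (hp : 1 <= p) (hj0 : 0 < j) (hc : closed_unit_speed_curve c).

Let pi0 : 0 < pi :> R. Proof. exact: pi_gt0. Qed.
Let twopi0 : 0 < 2 * pi :> R. Proof. by rewrite mulr_gt0. Qed.

Let cp z : c (z + 2 * pi) = c z.
Proof. by have := curve_periodicz hc 1 z; rewrite mulr1z mulr1. Qed.

Definition slice_energy (t : R) : \bar R :=
  (\int[mu]_(s in `[0%R, (2 * pi)%R]) okernel j p (enorm (c (s + t) - c s)) (circdist t))%E.

(** The integrand of the unit circle at shift t. It is constant in s, whence the factor 2 pi in each
    comparison with [slice_energy]. *)
Definition circle_slice (t : R) : \bar R := okernel j p (2 * sin (t / 2)) (circdist t).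

Let mcd d (T : measurableType d) (D : set T) (f : T -> R) :
  measurable_fun D f -> measurable_fun D (fun t => circdist (f t)).
Proof.
by move=> mf; apply: (measurableT_comp _ mf); apply: continuous_measurable_fun; exact: continuous_circdist.
Qed.

Let mF1 : measurable_fun [set: R * R] (fun z : R * R => okernel j p (enorm (c z.1 - c z.2)) (circdist (z.1 - z.2))).
Proof.
have m1 : measurable_fun [set: R * R] (fun z : R * R => z.1) by exact: measurable_fst.
have m2 : measurable_fun [set: R * R] (fun z : R * R => z.2) by exact: measurable_snd.
apply: measurable_okernel; first exact: measurable_chord.
by apply: mcd; exact: measurable_funB.
Qed.

Let mF2 : measurable_fun [set: R * R] (fun z : R * R => okernel j p (enorm (c (z.1 + z.2) - c z.1)) (circdist z.2)).
Proof.
have m1 : measurable_fun [set: R * R] (fun z : R * R => z.1) by exact: measurable_fst.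
have m2 : measurable_fun [set: R * R] (fun z : R * R => z.2) by exact: measurable_snd.
apply: measurable_okernel; last exact: mcd.
by apply: measurable_chord => //; exact: measurable_funD.
Qed.

Lemma measurable_slice_energy : measurable_fun `[0, 2 * pi] slice_energy.
Proof.
apply: (@measurable_section_integral _ _ _ _ R mu `[0, 2 * pi] `[0, 2 * pi] _ _ _ mF2) => //.
by move=> z; exact: okernel_ge0.
Qed.

(** At fixed s, the substitution t -> t + s is a translation of a periodic function over a full
    period. Tonelli's theorem then exchanges the order so that the shift becomes the outer
    variable. *)
Lemma ohara_energyE : ohara_energy j p c = (\int[mu]_(t in `[0%R, (2 * pi)%R]) slice_energy t)%E.
Proof.
pose F1 (z : R * R) := okernel j p (enorm (c z.1 - c z.2)) (circdist (z.1 - z.2)).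
pose F2 (z : R * R) := okernel j p (enorm (c (z.1 + z.2) - c z.1)) (circdist z.2).
transitivity (\int[mu \x mu]_(z in `[0%R, (2 * pi)%R] `*` `[0%R, (2 * pi)%R]) F1 z)%E; first by [].
have F10 z : (0 <= F1 z)%E by exact: okernel_ge0.
have F20 z : (0 <= F2 z)%E by exact: okernel_ge0.
have mI : measurable `[0, 2 * pi :> R]%classic by exact: measurable_itv.
rewrite (integral_rectangle1 mu mu mI mI mF1 F10).
transitivity (\int[mu \x mu]_(z in `[0%R, (2 * pi)%R] `*` `[0%R, (2 * pi)%R]) F2 z)%E; last first.
  by rewrite (integral_rectangle2 mu mu mI mI mF2 F20).
rewrite (integral_rectangle1 mu mu mI mI mF2 F20).
apply: eq_integral => s; rewrite inE/= => s02.
have ms : measurable_fun [set: R] (fun t : R => okernel j p (enorm (c s - c t)) (circdist (s - t))).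
  apply: measurable_okernel.
    by apply: measurable_chord => //; exact: measurable_cst.
  by apply: mcd; apply: measurable_funB => //; exact: measurable_cst.
have f0 (t : R) : (0 <= okernel j p (enorm (c s - c t)) (circdist (s - t)))%E.
  exact: okernel_ge0.
have fT (t : R) : okernel j p (enorm (c s - c (t + 2 * pi))) (circdist (s - (t + 2 * pi))) =
    okernel j p (enorm (c s - c t)) (circdist (s - t)).
  by rewrite cp opprD addrA -[in RHS](subrK (2 * pi) (s - t)) circdistD2pi.
have E := ge0_integral_periodic s02 ms f0 fT.
transitivity (\int[mu]_(x in `[0%R, (2 * pi)%R])
  okernel j p (enorm (c s - c (x + s)%R)) (circdist (s - (x + s)%R)))%E; first exact/esym/E.
apply: eq_integral => t _; rewrite enormB (addrC t s).
by rewrite opprD addrA subrr sub0r circdistN.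
Qed.

Lemma chord_lt_circdist (t : R) : 0 < t -> t < 2 * pi -> 0 < 2 * sin (t / 2) < circdist t.
Proof.
move=> t0 t2.
have h : 0 < t / 2 by rewrite divr_gt0.
have hs : 0 < sin (t / 2) by apply: sin_gt0_pi; rewrite h/=; lra.
rewrite mulr_gt0//= circdistE ?(ltW t0) ?(ltW t2)// lt_min.
have h2 : 0 < pi - t / 2 by lra.
have := sin_lt h2.
have -> : sin (pi - t / 2) = sin (t / 2) by rewrite sinB sinpi cospi; ring.
have := sin_lt h; move=> ? ?; apply/andP; split; lra.
Qed.

Lemma circle_slice_fin (t : R) : 0 < t -> t < 2 * pi -> circle_slice t \is a fin_num.
Proof.
move=> t0 t2; have /andP[h1 h2] := chord_lt_circdist t0 t2.
by rewrite /circle_slice okernelE// (lt_trans h1).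
Qed.

Lemma chord_le_circdist s t : enorm (c (s + t) - c s) <= circdist t.
Proof. by have := le_arcdist hc (s + t) s; rewrite arcdistE addrAC subrr add0r. Qed.

Let mchord D t : measurable_fun D (fun s : R => enorm (c (s + t) - c s)).
Proof.
by apply: measurable_chord => //; apply: measurable_funD => //; exact: measurable_cst.
Qed.

(** Integrating [okernel_tangent] over s leaves h times the integral of [X]^2, which
    [sqchord_mean_le] bounds by h 2 pi r^2, and this cancels. If equality holds, strictness of the
    tangent inequality gives [X] = r almost everywhere, and the Lipschitz bound carries this to
    every s. *)
Lemma slice_energy_ge (t : R) : 0 < t -> t < 2 * pi ->
  (circle_slice t * (2 * pi)%:E <= slice_energy t)%E /\
  (slice_energy t = (circle_slice t * (2 * pi)%:E)%E ->
    forall s, 0 <= s <= 2 * pi -> enorm (c (s + t) - c s) = 2 * sin (t / 2)).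
Proof.
move=> t0 t2; have /andP[r0 ry] := chord_lt_circdist t0 t2.
set r := 2 * sin (t / 2) in r0 ry *; set y := circdist t in ry *.
have [h h0 H] := okernel_tangent hj0 hp r0 ry.
pose X (s : R) := enorm (c (s + t) - c s).
have gfin := circle_slice_fin t0 t2.
have X0 s : 0 <= X s by exact: enorm_ge0.
have Xy s : X s <= y by exact: chord_le_circdist.
have mX : measurable_fun `[0, 2 * pi] X by exact: mchord.
have G := sqchord_mean_le hc (introT andP (conj (ltW t0) (ltW t2))).
have mok : measurable_fun `[0, 2 * pi] (fun s => okernel j p (X s) y).
  by apply: measurable_okernel => //; exact: measurable_cst.
have mX2 : measurable_fun `[0, 2 * pi] (fun s => (h * X s ^+ 2)%:E).
  apply/measurable_EFinP; apply: measurable_funM; first exact: measurable_cst.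
  exact: measurable_funX.
(* The quadratic terms are added on both sides, so that both integrands are nonnegative and nothing
   is subtracted from a possibly infinite kernel. *)
pose f1 (s : R) := (circle_slice t + (h * r ^+ 2)%:E)%E.
pose f2 (s : R) := (okernel j p (X s) y + (h * X s ^+ 2)%:E)%E.
have f12 s : (f1 s <= f2 s)%E.
  have [e|ne] := eqVneq (X s) r; first by rewrite /f1 /f2 e.
  by apply/ltW; exact: H.
have hr0 : 0 <= h * r ^+ 2 by rewrite mulr_ge0 ?sqr_ge0// ltW.
have hr1 : 0 <= h * r ^+ 2 * (2 * pi) by rewrite mulr_ge0// ltW.
have hX0 s : 0 <= h * X s ^+ 2 by rewrite mulr_ge0 ?sqr_ge0// ltW.
have If1 : (\int[mu]_(s in `[0%R, (2 * pi)%R]) f1 s = circle_slice t * (2 * pi)%:E + (h * r ^+ 2 * (2 * pi))%:E)%E.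
  by rewrite integral_cst_period /f1 ge0_muleDl ?okernel_ge0 ?lee_fin.
have If2 : (\int[mu]_(s in `[0%R, (2 * pi)%R]) f2 s <= slice_energy t + (h * r ^+ 2 * (2 * pi))%:E)%E.
  rewrite ge0_integralD//; last 2 first.
  - by move=> s _; exact: okernel_ge0.
  - by move=> s _; rewrite lee_fin hX0.
  rewrite leeD2l//.
  have IX : (\int[mu]_(s in `[0%R, (2 * pi)%R]) (h * X s ^+ 2)%:E = h%:E * sqchord_mean c t)%E.
    rewrite -ge0_integralZl//.
    - by apply/measurable_EFinP; exact: measurable_funX.
    - by move=> s _; rewrite lee_fin sqr_ge0.
    - by rewrite lee_fin ltW.
  have -> : h * r ^+ 2 * (2 * pi) = h * (2 * pi * r ^+ 2) by ring.
  rewrite EFinM; apply: le_trans (lee_wpmul2l _ G); last by rewrite lee_fin ltW.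
  by rewrite le_eqVlt; apply/orP; left; apply/eqP; exact: IX.
have mf1 : measurable_fun `[0, 2 * pi] f1 by exact: measurable_cst.
have mf2 : measurable_fun `[0, 2 * pi] f2 by exact: emeasurable_funD.
have f10 s : (0 <= f1 s)%E.
  by rewrite adde_ge0 ?okernel_ge0// lee_fin.
have hfin : ((h * r ^+ 2 * (2 * pi))%:E : \bar R) \is a fin_num by [].
split.
  rewrite -(leeD2rE _ _ hfin) -If1; apply: le_trans If2.
  by apply: ge0_le_integral => // s _; exact: le_trans (f12 s).
move=> e s s02.
have ae : {ae mu, forall s : R, `[0, (2 * pi)]%classic s -> f1 s = f2 s}.
  apply: (@ae_eq_of_integral_le _ (measurableTypeR R) R mu `[0, (2 * pi)]%classic f1 f2) => //.
  - by move=> s' _; rewrite fin_numD gfin.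
  - by rewrite If1 -ge0_fin_numE ?fin_numD ?fin_numM// adde_ge0 ?mule_ge0 ?okernel_ge0// lee_fin ltW.
  - by rewrite If1 -e.
have ae' : {ae mu, forall y : R, `]0, (2 * pi)[%classic y -> X y = r}.
  apply: (@ae_mono R _ _ ae) => s' H' s'02.
  apply: contrapT => /eqP ne.
  have : (f1 s' < f2 s')%E by exact: H.
  by rewrite H' ?ltxx//; exact: subset_itv_oo_cc s'02.
apply: eq_of_dist_le => e' e'0; have [s' s'02 [ss' Xs']] := ae_dense_itv twopi0 s02 e'0 ae'.
rewrite -/(X s) -Xs' /X.
have h1 := curve_lipschitz hc (s + t) (s' + t).
have h2 := curve_lipschitz hc s s'.
rewrite (_ : s + t - (s' + t) = s - s') in h1; last by ring.
rewrite distrC in ss'.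
set A := c (s + t) in h1 *; set B := c s in h2 *.
set A' := c (s' + t) in h1 *; set B' := c s' in h2 *.
have t1 : enorm (A - B) <= enorm (A - A') + (enorm (A' - B') + enorm (B' - B)).
  apply: le_trans (enorm_triangleB A A' B) _; rewrite lerD2l.
  exact: enorm_triangleB.
have t3 : enorm (A' - B') <= enorm (A' - A) + (enorm (A - B) + enorm (B - B')).
  apply: le_trans (enorm_triangleB A' A B') _; rewrite lerD2l.
  exact: enorm_triangleB.
rewrite (enormB B' B) in t1; rewrite (enormB A' A) in t3.
by rewrite ler_norml; apply/andP; split; lra.
Qed.

Lemma measurable_circle_slice (D : set R) : measurable_fun D circle_slice.
Proof.
apply: measurable_okernel; last exact: mcd.
apply: measurable_funM; first exact: measurable_cst.
apply: (measurableT_comp (f := @sin R)).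
  by apply: continuous_measurable_fun; exact: continuous_sin.
by apply: measurable_funM => //; exact: measurable_cst.
Qed.

Lemma circle_slice_double (u : R) : 0 <= u <= pi / 2 ->
  circle_slice (2 * u) = ((2 `^ (- (j * p)))%:E * okernel j p (sin u) u)%E.
Proof.
move=> /andP[u0 up]; rewrite /circle_slice.
have -> : 2 * u / 2 = u by rewrite mulrC mulKf// pnatr_eq0.
rewrite circdistE; last by apply/andP; split; lra.
have -> : Num.min (2 * u) (2 * pi - 2 * u) = 2 * u.
  by apply/min_idPl; lra.
move: u0; rewrite le_eqVlt => /predU1P[<-|u0].
  by rewrite sin0 mulr0 okernel00// mule0.
have su : 0 < sin u by apply: sin_gt0_pi; rewrite u0/=; lra.
by rewrite okernelZ//; exact: ltW (sin_lt u0).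
Qed.

(** The symmetry t -> 2 pi - t gives one factor 2, and the substitution t = 2u the other. *)
Lemma integral_circle_slice :
  (\int[mu]_(t in `[0%R, (2 * pi)%R]) circle_slice t =
   4%:E * \int[mu]_(u in `[0%R, (pi / 2)%R]) circle_slice (2 * u)%R)%E.
Proof.
have g0 (t : R) : (0 <= circle_slice t)%E by exact: okernel_ge0.
have pi2 : pi <= 2 * pi :> R by rewrite ler_pMl// ler1n.
have mcs D : measurable_fun D circle_slice by exact: measurable_circle_slice.
have g0D (D : set R) (x : R) : D x -> (0 <= circle_slice x)%E by [].
rewrite (@ge0_integral_itv_split R 0 pi (2 * pi) circle_slice (ltW pi0) pi2 (mcs _) g0).
have mI a b : measurable `[a, b :> R]%classic by exact: measurable_itv.
have -> : (\int[mu]_(t in `[pi, (2 * pi)%R]) circle_slice t =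
    \int[mu]_(t in `[0%R, pi]) circle_slice t)%E.
  have N1 : -1 != 0 :> R by rewrite oppr_eq0 oner_neq0.
  rewrite (@ge0_integral_affine R (-1) (2 * pi) _ circle_slice N1 (mI _ _) (mcs _) (g0D _)).
  rewrite normrN1 mul1e.
  have -> : (fun x : R => -1 * x + 2 * pi) @^-1` `[pi, 2 * pi] = `[0, pi]%classic.
    by apply/seteqP; split => x /=; rewrite !in_itv/= => /andP[h1 h2]; apply/andP; split; lra.
  apply: eq_integral => x _; rewrite /circle_slice circdistD2pi mulN1r circdistN.
  congr (okernel j p (2 * _) _).
  have -> : (- x + 2 * pi) / 2 = pi - x / 2 by field.
  by rewrite sinB sinpi cospi; ring.
have two0 : 2 != 0 :> R by rewrite pnatr_eq0.
rewrite (@ge0_integral_affine R 2 0 _ circle_slice two0 (mI _ _) (mcs _) (g0D _)).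
have -> : (fun x : R => 2 * x + 0) @^-1` `[0, pi] = `[0, pi / 2]%classic.
  by apply/seteqP; split => x /=; rewrite !in_itv/= => /andP[h1 h2]; apply/andP; split; lra.
have -> : (\int[mu]_(x in `[0%R, (pi / 2)%R]) circle_slice (2 * x + 0)%R =
    \int[mu]_(u in `[0%R, (pi / 2)%R]) circle_slice (2 * u)%R)%E.
  by apply: eq_integral => x _; rewrite addr0.
rewrite ger0_norm// -ge0_muleDl// -EFinD.
by congr (_%:E * _)%E; ring.
Qed.

(** The bound inverts before taking the power j, the kernel after. At s = 0 both integrands are (+oo
    - +oo)^p = 0. *)
Lemma circle_bound_okernel :
  circle_bound j p = ((2 `^ (3 - j * p) * pi)%:E *
    \int[mu]_(s in `[0%R, (pi / 2)%R]) okernel j p (sin s) s)%E.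
Proof.
congr (_ * _)%E; apply: eq_integral => u; rewrite inE/= in_itv/= => /andP[u0 up].
move: u0; rewrite le_eqVlt => /predU1P[<-|u0].
  rewrite sin0 okernel00// inver eqxx poweRyr ?gt_eqF//=.
  by rewrite gt_eqF// (lt_le_trans ltr01).
have su : 0 < sin u by apply: sin_gt0_pi; rewrite u0/=; lra.
by rewrite okernelE// !inver !gt_eqF// !poweR_EFin !powRV ?ltW.
Qed.

(** Origin of the constant: 4 from [integral_circle_slice], 2^(-jp) from the homogeneity of the
    kernel and 2 pi from the integral over s multiply to 2^(3 - jp) pi. *)
Lemma circle_boundE :
  circle_bound j p = (\int[mu]_(t in `[0%R, (2 * pi)%R]) (circle_slice t * (2 * pi)%:E))%E.
Proof.
have mI a b : measurable `[a, b :> R]%classic by exact: measurable_itv.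
have -> : (\int[mu]_(t in `[0%R, (2 * pi)%R]) (circle_slice t * (2 * pi)%:E) =
    \int[mu]_(t in `[0%R, (2 * pi)%R]) circle_slice t * (2 * pi)%:E)%E.
  apply: ge0_integralZr; first exact: mI.
  - exact: measurable_circle_slice.
  - by move=> t _; exact: okernel_ge0.
  - by rewrite lee_fin ltW.
rewrite integral_circle_slice.
have -> : (\int[mu]_(u in `[0%R, (pi / 2)%R]) circle_slice (2 * u)%R =
    \int[mu]_(u in `[0%R, (pi / 2)%R]) ((2 `^ (- (j * p)))%:E * okernel j p (sin u) u))%E.
  by apply: eq_integral => u; rewrite inE/= in_itv/=; exact: circle_slice_double.
have mok : measurable_fun `[0, (pi / 2)] (fun u : R => okernel j p (sin u) u).
  apply: measurable_okernel => //.
  by apply: measurable_funTS; apply: continuous_measurable_fun; exact: continuous_sin.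
have -> : (\int[mu]_(u in `[0%R, (pi / 2)%R]) ((2 `^ (- (j * p)))%:E * okernel j p (sin u) u) =
    (2 `^ (- (j * p)))%:E * \int[mu]_(u in `[0%R, (pi / 2)%R]) okernel j p (sin u) u)%E.
  apply: ge0_integralZl; [exact: mI|exact: mok| |].
  - by move=> u _; exact: okernel_ge0.
  - by rewrite lee_fin powR_ge0.
rewrite circle_bound_okernel [X in (X * _%:E)%E]muleA [RHS]muleAC -!EFinM; congr (_%:E * _)%E.
rewrite powRB ?pnatr_eq0 ?implybT//.
have -> : 2 `^ 3 = 8 :> R by rewrite (powR_mulrn 3 (ler0n R 2)) -natrX.
by rewrite powRN; field.
Qed.

Lemma slice_energy_round t : round_unit_circle c -> 0 <= t <= 2 * pi ->
  slice_energy t = (circle_slice t * (2 * pi)%:E)%E.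
Proof.
move=> [x0 [u [v [u1 v1 uv cE]]]] /andP[t0 t2].
rewrite -(integral_cst_period (R := R)); apply: eq_integral => s _.
rewrite /circle_slice; congr (okernel j p _ _).
have st : 0 <= 2 * sin (t / 2).
  by rewrite mulr_ge0// sin_ge0_pi//; apply/andP; split; lra.
apply/eqP; rewrite -(eqrXn2 (isT : (0 < 2)%N) (enorm_ge0 _) st) sqr_enorm !cE.
have -> : x0 + cos (s + t) *: u + sin (s + t) *: v - (x0 + cos s *: u + sin s *: v) =
  (cos (s + t) - cos s) *: u + (sin (s + t) - sin s) *: v.
  by apply/rowP => i; rewrite !mxE; ring.
rewrite !(dotvDl, dotvDr, dotvZl, dotvZr) (dotvC v u) uv -!sqr_enorm u1 v1.
(* In terms of the midpoint angle a, the chord is 2 sin(t/2) times the unit vector -sin a u + cos a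
   v. *)
have [a aE] : exists a : R, a = s + t / 2 by exists (s + t / 2).
have -> : s + t = a + t / 2 by rewrite aE; field.
have -> : cos s = cos (a - t / 2) by congr cos; rewrite aE; field.
have -> : sin s = sin (a - t / 2) by congr sin; rewrite aE; field.
rewrite cosD sinD cosB sinB; apply/eqP.
transitivity ((2 * sin (t / 2)) ^+ 2 * (cos a ^+ 2 + sin a ^+ 2)); first by ring.
by rewrite cos2Dsin2 mulr1.
Qed.

(** On the unit circle c 0 and c pi are antipodal, so the center can only be their midpoint [x0].
    Chord lengths then give all inner products of the vectors e t = c t - x0, and these force e t =
    cos t u + sin t v. *)
Lemma isometric_round_circle :
  (forall s t, 0 <= s <= 2 * pi -> 0 <= t <= 2 * pi -> enorm (c (s + t) - c s) = 2 * sin (t / 2)) ->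
  round_unit_circle c.
Proof.
move=> H.
have chord s t : 0 <= s <= 2 * pi -> enorm (c t - c s) ^+ 2 = 2 - 2 * cos (t - s).
  move=> s02.
  pose k := Num.floor ((t - s) / (2 * pi)).
  have := real_floor_itv (num_real ((t - s) / (2 * pi))).
  rewrite -/k => /andP[k1 k2].
  rewrite ler_pdivlMr// in k1; rewrite ltr_pdivrMr// intrD mulrDl mul1r in k2.
  pose t' := t - s - k%:~R * (2 * pi).
  have t'02 : 0 <= t' <= 2 * pi by rewrite /t'; apply/andP; split; lra.
  have tE : t = s + t' + 2 * pi * k%:~R by rewrite /t'; ring.
  have -> : cos (t - s) = cos t'.
    have cosper (m : nat) x : cos (x + 2 * pi * m%:R) = cos x :> R.
      elim: m => [|m IH]; first by rewrite mulr0 addr0.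
      by rewrite -[in m.+1%:R]natr1 mulrDr mulr1 addrA (mulr_natl pi 2) cosD2pi -(mulr_natl pi 2).
    rewrite tE; have -> : s + t' + 2 * pi * k%:~R - s = t' + 2 * pi * k%:~R by ring.
    case: (k) => m; first exact: cosper.
    by rewrite NegzE mulrNz mulrN -[LHS](cosper m.+1) subrK.
  rewrite {1}tE (curve_periodicz hc) H// exprMn.
  have -> : cos t' = cos ((t' / 2) *+ 2) by congr cos; rewrite -mulr_natl; field.
  by rewrite cos_mulr2n cos2sin2; ring.
have m0 : 0 <= (0 : R) <= 2 * pi by rewrite lexx ltW.
have mpi : 0 <= (pi : R) <= 2 * pi by apply/andP; split; lra.
have mpi2 : 0 <= (pi / 2 : R) <= 2 * pi by apply/andP; split; lra.
pose x0 : 'rV[R]_n := 2^-1 *: (c 0 + c pi).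
pose u : 'rV[R]_n := 2^-1 *: (c 0 - c pi).
have [e eE] : exists e : R -> 'rV[R]_n, forall t, e t = c t - x0.
  by exists (fun t => c t - x0).
have eB s t : e t - e s = c t - c s by rewrite !eE opprB addrA subrK.
have eu : e 0 = u.
  by apply/rowP => i; rewrite eE /x0 /u !mxE; field.
have eu' : e pi = - u.
  by apply/rowP => i; rewrite eE /x0 /u !mxE; field.
have u1 : dotv u u = 1.
  by rewrite /u dotvZl dotvZr -sqr_enorm enormB chord// subr0 cospi; field.
clearbody u.
(* Parallelogram law: |e t - u|^2 + |e t + u|^2 = (2 - 2 cos t) + (2 + 2 cos t) = 4, while |u| =
   1. *)
have e1 t : dotv (e t) (e t) = 1.
  have h1 := chord 0 t m0; have h2 := chord pi t mpi.
  rewrite -eB eu subr0 sqr_enorm in h1.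
  rewrite -eB eu' opprK sqr_enorm cosB cospi sinpi in h2.
  move: h1 h2; rewrite dotv_sqrB dotv_sqrD u1; lra.
have ee s t : 0 <= s <= 2 * pi -> dotv (e t) (e s) = cos (t - s).
  move=> s02; have h := chord s t s02.
  by move: h; rewrite -eB sqr_enorm dotv_sqrB !e1; lra.
pose v := e (pi / 2).
have uv : dotv u v = 0 by rewrite -eu ee// sub0r cosN cos_pihalf.
exists x0, u, v; split => //.
- by rewrite /enorm u1 sqrtr1.
- by rewrite /enorm e1 sqrtr1.
- move=> t; apply/eqP; rewrite -subr_eq0; apply/eqP/dotv_eq0.
  have -> : c t - (x0 + cos t *: u + sin t *: v) = e t - (cos t *: u + sin t *: v).
    by rewrite eE -addrA opprD addrA.
  have etu : dotv (e t) u = cos t by rewrite -eu ee// subr0.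
  have etv : dotv (e t) v = sin t by rewrite ee// cosBpihalf.
  rewrite dotv_sqrB dotv_sqrD !(dotvDr, dotvZl, dotvZr) etu etv uv u1 !e1.
  have := cos2Dsin2 t => h.
  transitivity (1 - (cos t ^+ 2 + sin t ^+ 2)); first by ring.
  by rewrite h subrr.
Qed.

End Energy.

Theorem corollary1p3 (R : realType) (n : nat) (j p : R)
    (hn : (2 <= n)%N) (hp : 1 <= p) (hj0 : 0 < j) (hj : j < 2 + 1 / p)
    (c : R -> 'rV[R]_n) (hc : closed_unit_speed_curve c) :
  (circle_bound j p <= ohara_energy j p c)%E /\
  (ohara_energy j p c = circle_bound j p <-> round_unit_circle c).
Proof.
(* The endpoints are removed because the chord 2 sin(t/2) and the arc distance both vanish there,
   and the tangent argument needs them positive. *)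
pose D : set R := `]0, 2 * pi[%classic.
have pi0 : 0 < pi :> R by exact: pi_gt0.
have twopi0 : 0 < 2 * pi :> R by rewrite mulr_gt0.
have mD : measurable D by exact: measurable_itv.
pose f (t : R) := (circle_slice j p t * (2 * pi)%:E)%E.
pose g (t : R) := slice_energy j p c t.
have mg : measurable_fun D g.
  by apply: measurable_funS (measurable_slice_energy j p hc) => //; exact: subset_itv_oo_cc.
have mf : measurable_fun D f.
  by apply: emeasurable_funM; [exact: measurable_circle_slice|exact: measurable_cst].
have f0 t : (0 <= f t)%E by rewrite mule_ge0 ?okernel_ge0// lee_fin ltW.
have g0 t : (0 <= g t)%E by apply: integral_ge0 => s _; exact: okernel_ge0.
have eE : ohara_energy j p c = (\int[lebesgue_measure]_(t in D) g t)%E.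
  by rewrite (ohara_energyE j p hc) (integral_itv_bndoo _ _ mg).
have bE : circle_bound j p = (\int[lebesgue_measure]_(t in D) f t)%E.
  by rewrite (circle_boundE hp hj0) (integral_itv_bndoo _ _ mf).
have fg t : D t -> (f t <= g t)%E.
  rewrite /D/= in_itv/= => /andP[t0 t2].
  by have [] := slice_energy_ge hp hj0 hc t0 t2.
split; first by rewrite eE bE; exact: ge0_le_integral.
split=> [e|rc]; last first.
  rewrite eE bE; apply: eq_integral => t; rewrite inE /D/= in_itv/= => /andP[t0 t2].
  by apply: slice_energy_round => //; rewrite !ltW.
(* Finiteness of the bound is what turns equality of the integrals into equality of almost all
   slices. *)
have boo : (circle_bound j p < +oo)%E.
  rewrite circle_bound_okernel//; have := circle_integral_lty hj0 hp hj.
  by apply: lte_mul_pinfty => //; rewrite lee_fin mulr_ge0 ?powR_ge0 ?ltW.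
have ae : {ae lebesgue_measure, forall t : R, D t -> f t = g t}.
  apply: (@ae_eq_of_integral_le _ (measurableTypeR R) R lebesgue_measure D f g) => //.
  - move=> t; rewrite /D/= in_itv/= => /andP[t0 t2].
    by rewrite fin_numM// (circle_slice_fin j p t0 t2).
  - by rewrite -bE.
  - by rewrite -eE -bE e.
apply: (isometric_round_circle hc) => s t s02 t02.
have ae' : {ae lebesgue_measure, forall t : R, D t ->
    forall s, 0 <= s <= 2 * pi -> enorm (c (s + t) - c s) = 2 * sin (t / 2)}.
  apply: (@ae_mono R _ _ ae) => t' H Dt'.
  have := H Dt'; move: Dt'; rewrite /D/= in_itv/= => /andP[t'0 t'2] e'.
  by have [_] := slice_energy_ge hp hj0 hc t'0 t'2; apply; exact/esym.
(* From almost every t to every t: the chord at s and 2 sin(t/2) each change by at most |t - t'|. *)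
apply: eq_of_dist_le => e' e'0; have [t' Dt' [tt' /(_ s s02) H]] := ae_dense_itv twopi0 t02 e'0 ae'.
have h1 := curve_lipschitz hc (s + t) (s + t').
rewrite (_ : s + t - (s + t') = t - t') in h1; last by ring.
have h2 := sin_lipschitz (t / 2) (t' / 2).
rewrite (_ : t / 2 - t' / 2 = (t - t') / 2) in h2; last by field.
rewrite normrM [`|2^-1|]ger0_norm// in h2.
rewrite distrC in tt'.
have h3 := enorm_triangleB (c (s + t)) (c (s + t')) (c s).
have h4 := enorm_triangleB (c (s + t')) (c (s + t)) (c s).
rewrite (enormB (c (s + t')) (c (s + t))) H in h4; rewrite H in h3.
move: h2; rewrite ler_norml => /andP[h5 h6].
by rewrite ler_norml; apply/andP; split; lra.
Qed.
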